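(* Let $A\in\mathscr R$ be a fixed set, let $n\in\mathbb N$ be fixed, and let $\mathbf X^{(1)},\ldots,\mathbf X^{(n)}$ be random vectors in $[0,\infty)^d$ with distributions $F_1,\ldots,F_n$ respectively. Put $\mathbf S_n=\mathbf X^{(1)}+\cdots+\mathbf X^{(n)}$. Each of the following conditions implies $$\mathbf P[\mathbf S_n\in xA]\sim\sum_{i=1}^n\mathbf P[\mathbf X^{(i)}\in xA],\qquad x\to\infty:$$ (i) $\mathbf X^{(1)},\ldots,\mathbf X^{(n)}$ are quasi asymptotically independent on $A$ ($QAI_A$) and $F_1,\ldots,F_n\in\mathcal C_A$; (ii) $\mathbf X^{(1)},\ldots,\mathbf X^{(n)}$ are tail asymptotically independent on $A$ ($TAI_A$) and $F_1,\ldots,F_n\in(\mathcal D\cap\mathcal L)_A$; (iii) $\mathbf X^{(1)},\ldots,\mathbf X^{(n)}$ are regression dependent on $A$ ($RD_A$), $F_1,\ldots,F_n\in\mathcal S_A$, and $F_i*F_j\in\mathcal S_A$ for all $i,j\in\{1,\ldots,n\}$ with $i\ne j$.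
   Context: Fix an integer $d\ge 1$. $\mathscr R$ is the family of nonempty sets $A\subsetneq\mathbb R^d$ that are open, increasing (if $\mathbf x\in A$ and $\mathbf a\in[0,\infty)^d$ then $\mathbf x+\mathbf a\in A$), have convex complement $A^c$, and satisfy $\mathbf 0\notin\overline A$ (closure). For a random vector $\mathbf X$ in $[0,\infty)^d$ with distribution $F$ put $Y_A:=\sup\{u>0:\mathbf X\in uA\}$ (with $\sup\emptyset=0$), and let $F_A$ be the distribution of $Y_A$; its tail is $\overline F_A(x)=\mathbf P[Y_A>x]=\mathbf P[\mathbf X\in xA]$ for $x>0$. Write $Y_A^{(i)}:=\sup\{u>0:\mathbf X^{(i)}\in uA\}$. The components of each vector $\mathbf X^{(i)}$ may be arbitrarily dependent. For a distribution $V$ on $[0,\infty)$ write $\overline V=1-V$ and assume $\overline V(x)>0$ for all $x\ge0$. $V\in\mathcal C$ if $\lim_{b\uparrow1}\limsup_{x\to\infty}\overline V(bx)/\overline V(x)=1$. $V\in\mathcal D$ if $\limsup_{x\to\infty}\overline V(bx)/\overline V(x)<\infty$ for every (equivalently, some) $b\in(0,1)$. $V\in\mathcal L$ if $\lim_{x\to\infty}\overline V(x-y)/\overline V(x)=1$ for every (equivalently, some) $y>0$. $V\in\mathcal S$ (subexponential) if $\lim_{x\to\infty}\overline{V^{m*}}(x)/\overline V(x)=m$ for every (equivalently, some) integer $m\ge2$, $V^{m*}$ being the $m$-fold convolution. For $\mathcal B\in\{\mathcal C,\mathcal D\cap\mathcal L,\mathcal S\}$, $F\in\mathcal B_A$ means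 $F_A\in\mathcal B$. $F_i*F_j$ denotes the convolution, i.e. the distribution of the sum of two independent vectors with distributions $F_i$ and $F_j$. Dependence notions: - $QAI_A$: $\lim_{x\to\infty}\dfrac{\mathbf P[Y_A^{(i)}>x,\,Y_A^{(j)}>x]}{\mathbf P[Y_A^{(i)}>x]+\mathbf P[Y_A^{(j)}>x]}=0$ for all $i\ne j$ in $\{1,\ldots,n\}$. - $TAI_A$: $\lim_{x_i\wedge x_j\to\infty}\mathbf P[Y_A^{(i)}>x_i\mid Y_A^{(j)}>x_j]=0$ for all $i\ne j$ in $\{1,\ldots,n\}$. - $RD_A$: there exist constants $x_0$ and $C$ such that $\mathbf P[Y_A^{(i)}>x_i\mid Y_A^{(j)}=x_j\text{ for }j\in J_i]\le C\,\mathbf P[Y_A^{(i)}>x_i]$ for all $i=1,\ldots,n$, all $\emptyset\ne J_i\subseteq\{1,\ldots,n\}\setminus\{i\}$, and all $x_i$ and $x_j$, $j\in J_i$, with $x_i\wedge x_j>x_0$ for all $j\in J_i$ (conditional probabilities given values of random variables are understood in the usual regular sense). $f\sim g$ means $f(x)/g(x)\to1$ as $x\to\infty$; $x\wedge y=\min\{x,y\}$. *)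

(* Defs.v *)
From HB Require Import structures.
From mathcomp Require Import all_boot all_order all_algebra.
From mathcomp Require Import all_classical all_reals all_analysis.
Import Order.TTheory GRing.Theory Num.Theory.
From mathcomp Require Import measurable_realfun lra.
Import numFieldNormedType.Exports.

Set Implicit Arguments.
Unset Strict Implicit.
Unset Printing Implicit Defensive.

Local Open Scope classical_set_scope.
Local Open Scope ring_scope.

(* R^d with its Borel sigma-algebra; convertible to 'rV[R]_d. *)
Notation rvec R d := (g_sigma_algebraType (@open 'rV[R]_d)).

Definition dilate (R : realType) (d : nat) (u : R) (A : set 'rV[R]_d) :
  set 'rV[R]_d := [set u *: a | a in A].

Record rfamily (R : realType) (d : nat) := RFamily {
  rset :> set 'rV[R]_d ;
  rset_neq0 : rset !=set0 ;
  rset_neqT : rset <> setT ;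
  rset_open : open rset ;
  rset_increasing : forall x a : 'rV[R]_d,
    rset x -> (forall k, 0 <= a 0 k) -> rset (x + a) ;
  rset_convexC : convex_set (~` rset) ;
  rset_closure0 : ~ closure rset 0 }.

(* [sup] is 0 on the empty set, as wanted; it is also 0 on unbounded sets, but
   [ydir_has_ubound] shows that these do not occur. *)
Definition ydir (R : realType) (d : nat) (A : rfamily R d) (x : rvec R d) : R :=
  sup [set u : R | 0 < u /\ dilate u A x].

Section ydir_measurable.
Variables (R : realType) (d : nat) (A : rfamily R d).
Implicit Types x : 'rV[R]_d.

Lemma ydir_has_ubound x : has_ubound [set u : R | 0 < u /\ dilate u A x].
Proof.
have : nbhs (0 : 'rV[R]_d) (~` A).
  apply: contrapT => nA; apply: (@rset_closure0 _ _ A) => B B0.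
  apply: contrapT => AB; apply: nA; apply: filterS B0 => z Bz Az.
  by apply: AB; exists z.
case/nbhs_ballP => e /= e0 eA.
exists (`|x| / e) => u [u0 [a Aa <-]].
rewrite normrZ gtr0_norm// -mulrA ler_peMr ?(ltW u0)//.
rewrite ler_pdivlMr// mul1r leNgt.
apply/negP => ae; apply: (eA a) => //.
by rewrite -ball_normE /= sub0r normrN.
Qed.

Lemma ydir_ge0 x : 0 <= ydir A x.
Proof.
rewrite /ydir; set E := [set _ | _].
have [->|/set0P[u Eu]] := eqVneq E set0; first by rewrite sup0.
apply: (le_trans (ltW Eu.1)).
by apply: ub_le_sup => //; exact: ydir_has_ubound.
Qed.

Lemma ydir_gtP (r : R) x : 0 <= r ->
  r < ydir A x <-> exists2 u, r < u & dilate u A x.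
Proof.
move=> r0; split=> [|[u ru ux]].
  rewrite /ydir; set E := [set _ | _] => rE.
  have [E0|/set0P E0] := eqVneq E set0.
    by move: rE; rewrite E0 sup0 ltNge r0.
  by have [u [_ ux] ru] := sup_gt E0 rE; exists u.
apply: (lt_le_trans ru); apply: ub_le_sup; first exact: ydir_has_ubound.
by split=> //; exact: le_lt_trans ru.
Qed.

Lemma open_dilate (u : R) : 0 < u -> open (dilate u A).
Proof.
move=> u0.
have -> : dilate u A = ( *:%R u^-1) @^-1` A.
  apply/seteqP; split=> [_ [a Aa <-]|z Az] /=.
    by rewrite scalerA mulVf ?gt_eqF// scale1r.
  by exists (u^-1 *: z) => //; rewrite scalerA mulfV ?gt_eqF// scale1r.
apply: open_comp; last exact: rset_open.
by move=> z _; exact: scaler_continuous.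
Qed.

Lemma measurable_ydir : measurable_fun [set: rvec R d] (ydir A).
Proof.
apply: (measurability _ (RGenOInfty.measurableE R)) => _ [_ [r ->] <-].
rewrite setTI; have [r0|r0] := leP 0 r; last first.
  rewrite (_ : _ @^-1` _ = setT); first exact: measurableT.
  apply/seteqP; split=> // x _ /=.
  by rewrite in_itv/= andbT (lt_le_trans r0)// ydir_ge0.
apply: sub_sigma_algebra.
rewrite (_ : _ @^-1` _ = \bigcup_(u in [set u | r < u]) dilate u A).
  apply: bigcup_open => u /= ru; apply: open_dilate; exact: le_lt_trans ru.
apply/seteqP; split=> x /=; rewrite in_itv/= andbT.
  by move=> /(ydir_gtP _ r0)[u ru ux]; exists u.
by move=> [u ru ux]; apply/(ydir_gtP _ r0); exists u.
Qed.

HB.instance Definition _ :=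
  isMeasurableFun.Build _ _ _ _ (ydir A) measurable_ydir.

End ydir_measurable.

Section addition.
Variables (R : realType) (d : nat).

Definition radd (z : R * R) : R := z.1 + z.2.

Lemma measurable_radd : measurable_fun setT radd.
Proof. exact: measurable_funD. Qed.

HB.instance Definition _ :=
  isMeasurableFun.Build _ _ _ _ radd measurable_radd.

Lemma measurable_coord (k : 'I_d) :
  measurable_fun [set: rvec R d] (fun v : rvec R d => (v : 'rV[R]_d) 0 k).
Proof.
apply: (measurability _ (RGenOpens.measurableE R)) => _ [_ [a [b ->]] <-].
rewrite setTI; apply: sub_sigma_algebra.
apply: (@open_comp _ _ (fun v : 'rV[R]_d => v 0 k)); last exact: interval_open.
by move=> v _; exact: coord_continuous.
Qed.

(* Every open set is a countable union of boxes with rational centres. *)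
Lemma measurable_fun_rvec disp (T : measurableType disp) (f : T -> rvec R d) :
  (forall k, measurable_fun setT (fun w => (f w : 'rV[R]_d) 0 k)) ->
  measurable_fun setT f.
Proof.
move=> mf; apply: (@measurability _ _ T (rvec R d) setT f (@open 'rV[R]_d)) => //.
move=> _ [U oU <-]; rewrite setTI.
pose bx (q : 'rV[rat]_d * nat) : set 'rV[R]_d :=
  [set v | forall k, ratr (q.1 0 k) - q.2.+1%:R^-1 < v 0 k
                     < ratr (q.1 0 k) + q.2.+1%:R^-1].
rewrite (_ : U = \bigcup_q (if `[< bx q `<=` U >] then bx q else set0)).
  rewrite preimage_bigcup; apply: countable_bigcupT_measurable => //.
  move=> q; case: ifPn => _; last by rewrite preimage_set0.
  rewrite (_ : _ @^-1` _ = \bigcap_(k in [set: 'I_d])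
      ((fun w => (f w : 'rV[R]_d) 0 k) @^-1`
        `]ratr (q.1 0 k) - q.2.+1%:R^-1, ratr (q.1 0 k) + q.2.+1%:R^-1[)).
    rewrite -[X in measurable X]setCK setC_bigcap; apply: measurableC.
    apply: countable_bigcupT_measurable => // k; apply: measurableC.
    by rewrite -[X in measurable X]setTI; exact: mf.
  apply/seteqP; split=> w /= h k => [_|].
    by have := h k; rewrite /= in_itv.
  by have := h k Logic.I; rewrite /= in_itv.
apply/seteqP; split=> [v Uv|v [q _]]; last first.
  by case: ifPn => // /asboolP; apply.
have /nbhs_ballP[e /= e0 eU] := open_nbhs_nbhs (conj oU Uv).
have [m me] : exists m : nat, m.+1%:R^-1 < e / 2 :> R.
  have e20 : 0 < e / 2 by rewrite divr_gt0.
  exists (Num.truncn (e / 2)^-1).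
  by rewrite invf_plt ?posrE// truncnS_gt.
have /choice[q qv] : forall k : 'I_d, exists q : rat,
    v 0 k - m.+1%:R^-1 < ratr q < v 0 k + m.+1%:R^-1.
  move=> k.
  have /rat_in_itvoo[q] : v 0 k - m.+1%:R^-1 < v 0 k + m.+1%:R^-1.
    by rewrite ltrD2l gtrN.
  by rewrite in_itv/= => h; exists q.
have qv' k : ratr (q k) - m.+1%:R^-1 < v 0 k < ratr (q k) + m.+1%:R^-1.
  have /andP[] := qv k.
  by rewrite ltrBlDr -ltrBlDr => ? ?; apply/andP; split;
     rewrite ?ltrBlDr// -ltrBlDr.
exists (\row_k q k, m) => //; rewrite ifT.
  by rewrite /bx /= => k; rewrite mxE.
apply/asboolP => z zq; apply: eU; split=> // i k.
rewrite (ord1 i) /ball /= /ball_ /=.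
have := zq k; rewrite /= mxE => /andP[z1 z2]; have /andP[q1 q2] := qv k.
rewrite ltr_norml; apply/andP.
by move: me z1 z2 q1 q2; set c := _^-1; split; lra.
Qed.

Definition vadd (z : rvec R d * rvec R d) : rvec R d :=
  (z.1 : 'rV[R]_d) + (z.2 : 'rV[R]_d).

Lemma measurable_vadd : measurable_fun setT vadd.
Proof.
apply: measurable_fun_rvec => k.
rewrite (_ : (fun _ => _) = fun z : rvec R d * rvec R d =>
    (z.1 : 'rV[R]_d) 0 k + (z.2 : 'rV[R]_d) 0 k); last first.
  by apply/funext => z; rewrite mxE.
apply: measurable_funD.
- exact: (measurableT_comp (measurable_coord k) measurable_fst).
- exact: (measurableT_comp (measurable_coord k) measurable_snd).
Qed.

HB.instance Definition _ :=
  isMeasurableFun.Build _ _ _ _ vadd measurable_vadd.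

End addition.

Definition prob (R : realType) disp (T : measurableType disp)
  (P : probability T R) (E : set T) : R := fine (P E).

Definition asymp_equiv (R : realType) (f g : R -> R) : Prop :=
  f x / g x @[x --> +oo] --> (1 : R).

Section distributions.
Variable R : realType.
Implicit Types V W : probability R R.

Definition tail V (x : R) : R := prob V `]x, +oo[%classic.

Definition dconv V W : probability R R :=
  distribution (V \x W)%E (@radd R).

(* [dconvn V m] is the [m]-fold convolution for [m >= 1]. *)
Definition dconvn V (m : nat) := iter m.-1 (dconv V) V.

(* The standing assumptions on V: carried by [0, +oo[, with unbounded support. *)
Definition halfline_dist V : Prop :=
  V `]-oo, 0[%classic = 0%E /\ forall x, 0 <= x -> 0 < tail V x.

Definition limsup_tail V (b : R) : \bar R :=
  limf_esup (fun x : R => (tail V (b * x) / tail V x)%:E) (pinfty_nbhs R).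

Definition class_C V : Prop :=
  halfline_dist V /\ limsup_tail V b @[b --> 1^'-] --> 1%E.

Definition class_D V : Prop :=
  halfline_dist V /\ forall b, 0 < b < 1 -> (limsup_tail V b < +oo)%E.

Definition class_L V : Prop :=
  halfline_dist V /\ forall y, 0 < y ->
    tail V (x - y) / tail V x @[x --> +oo] --> (1 : R).

Definition class_DL V : Prop := class_D V /\ class_L V.

Definition class_S V : Prop :=
  halfline_dist V /\ forall m, (2 <= m)%N ->
    tail (dconvn V m) x / tail V x @[x --> +oo] --> (m%:R : R).

End distributions.

Section vector_distributions.
Variables (R : realType) (d : nat).
Implicit Types F G : probability (rvec R d) R.

Definition vlaw disp (T : measurableType disp) (P : probability T R)
    (X : {mfun T >-> rvec R d}) : probability (rvec R d) R :=
  distribution P X.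

Definition vconv F G : probability (rvec R d) R :=
  distribution (F \x G)%E (@vadd R d).

Definition dirdist (A : rfamily R d) F : probability R R :=
  distribution F (ydir A).

Definition on_set (B : probability R R -> Prop)
    (A : rfamily R d) F : Prop := B (dirdist A F).

End vector_distributions.

Section dependence.
Context {R : realType} {disp} {T : measurableType disp}.
Variables (P : probability T R) (n : nat) (Y : 'I_n -> T -> R).

Local Notation Pr := (prob P).

Definition QAI : Prop := forall i j, i != j ->
  Pr [set w | x < Y i w /\ x < Y j w] /
    (Pr [set w | x < Y i w] + Pr [set w | x < Y j w])
  @[x --> +oo] --> (0 : R).

(* min(x_i, x_j) --> +oo iff (x_i, x_j) tends to +oo along the product filter. *)
Definition TAI : Prop := forall i j, i != j ->
  (fun z : R * R => Pr [set w | z.1 < Y i w /\ z.2 < Y j w] /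
                    Pr [set w | z.2 < Y j w])
  @ filter_prod (pinfty_nbhs R) (pinfty_nbhs R) --> (0 : R).

Definition subtuple (J : {set 'I_n}) (w : T) :
  #|J|.-tuple R := [tuple Y (enum_val k) w | k < #|J|].

Definition regular_cond_dist (i : 'I_n) (J : {set 'I_n})
    (K : R.-pker #|J|.-tuple R ~> R) : Prop :=
  forall (B : set R)
         (D : set (#|J|.-tuple R)),
    measurable B -> measurable D ->
    (P (Y i @^-1` B `&` subtuple J @^-1` D) =
      \int[P]_(w in subtuple J @^-1` D) K (subtuple J w) B)%E.

(* A conditional distribution is determined only up to null sets of values of
   the conditioning vector, so the bound is required of some version of it. *)
Definition RD : Prop := exists x0 C : R,
  forall (i : 'I_n) (J : {set 'I_n}), J != finset.set0 -> i \notin J ->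
  exists2 K : R.-pker #|J|.-tuple R ~> R,
    regular_cond_dist i K &
    forall (x : R) (y : #|J|.-tuple R),
      (forall k, x0 < Num.min x (tnth y k)) ->
      (K y `]x, +oo[%classic <= C%:E * P [set w | (x < Y i w)%R])%E.

End dependence.

(* Main.v *)
Require Import Defs.
From HB Require Import structures.
From mathcomp Require Import all_boot all_order all_algebra.
From mathcomp Require Import all_classical all_reals all_analysis.
Import Order.TTheory GRing.Theory Num.Theory.
From mathcomp Require Import measurable_realfun lra ring.
Import numFieldNormedType.Exports.
Set Implicit Arguments.
Unset Strict Implicit.
Unset Printing Implicit Defensive.
Local Open Scope classical_set_scope.
Local Open Scope ring_scope.

(** For [x > 0] a vector lies in [x A] exactly when its gauge [ydir A] exceeds
    [x] ([dilate_ydir]). Since the complement of [A] is convex and [A] is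
    increasing, the gauge is subadditive and monotone on the orthant, so with
    [Y i] the gauge of [X i] and [S] the gauge of the sum of the vectors,
    [Y i <= S <= \sum_i Y i]. The statement is thereby about real random
    variables: the tail of [S] is squeezed between that of the maximum and that
    of the sum of the [Y i].

    By [sum_tails_asymp_equiv], two estimates suffice, both relative to the sum
    [G x] of the tails. First, two of the [Y i] rarely exceed [x] together.
    Second, there is an allowance [h x] such that the tails at [x - h x] add up
    to at most [(1 + e) G x] while the sum rarely exceeds [x] without some
    [Y i] exceeding [x - h x]. In that remainder event at least two terms are
    large ([two_large_terms]).

    - For consistently varying tails, [h x] is a small multiple of [x]; both
      terms exceed a multiple of [x], and quasi asymptotic independence
      applies directly ([QAI_remainder_le]).
    - For long, dominatedly varying tails, [h] is a constant; one term exceeds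
      [x / n] and the other a fixed level, and tail asymptotic independence
      bounds the corresponding conditional probability ([TAI_remainder_le]).
    - For subexponential tails, [h] is again a constant, [n L]. The remainder
      event forces the terms above [L], at least two in number, to have a sum
      above [x - n L]. Regression dependence compares them with independent
      copies ([RD_step], [RD_sum_negligible]), which reduces the claim to two
      independent variables: their sum rarely exceeds [x] while both exceed
      [L]. For a single subexponential law this is [class_S_both_large]. For
      [V i] and [V j] with [i != j] it is deduced in [both_large_negligible]
      from the subexponentiality of the gauge [H] of [X i + X j] for
      independent vectors, because the tail of [H] lies above those of [V i]
      and [V j] ([tail_le_vconv]) and below that of their convolution
      ([tail_vconv_le]). *)

(** * The gauge of the complement *)

Section gauge.
Variables (R : realType) (d : nat) (A : rfamily R d).
Implicit Types x y a : 'rV[R]_d.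

Lemma dilateE (u : R) x : 0 < u -> dilate u A x <-> rset A (u^-1 *: x).
Proof.
move=> u0; split=> [[a Aa <-]|Ax].
  by rewrite scalerA mulVf ?gt_eqF// scale1r.
by exists (u^-1 *: x) => //; rewrite scalerA mulfV ?gt_eqF// scale1r.
Qed.

Lemma complement_convex (s : R) x y : 0 <= s <= 1 ->
  ~ rset A x -> ~ rset A y -> ~ rset A (s *: x + (1 - s) *: y).
Proof.
move=> /andP[s0 s1] nAx nAy.
have s01 : Itv.spec (@Itv.num_sem R) (Itv.Real `[0%Z, 1%Z]) s.
  by rewrite /= /Itv.num_sem/= realE s0/= in_itv/= s0 s1.
have := @rset_convexC _ _ A x y (Itv.mk s01).
rewrite !inE; apply => //.
Qed.

Lemma complement_shrink (s : R) x : 0 <= s <= 1 -> ~ rset A x -> ~ rset A (s *: x).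
Proof.
move=> s01 nAx; rewrite -[_ *: x]addr0 -(scaler0 _ (1 - s)).
apply: complement_convex => // A0.
by apply: (@rset_closure0 _ _ A); exact: subset_closure.
Qed.

(** The complement of [A] is star-shaped about the origin, so the dilates
    [u A] shrink as [u] grows. *)
Lemma dilate_antimono (u v : R) x : 0 < u -> u <= v ->
  dilate v A x -> dilate u A x.
Proof.
move=> u0 uv; have v0 := lt_le_trans u0 uv.
move=> /(dilateE _ v0) Avx; apply/(dilateE _ u0); apply: contrapT => nA.
have := @complement_shrink (u / v) _ _ nA.
rewrite scalerA mulrAC divff ?gt_eqF// mul1r; apply => //.
by rewrite divr_ge0 ?(ltW u0) ?(ltW v0)//= ler_pdivrMr// mul1r.
Qed.

(** The [u > 0] with [x] in [u A] form an interval starting at 0, which is open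
    on the right because [A] is open: hence the strict inequality. *)
Lemma dilate_ydir (u : R) x : 0 < u -> dilate u A x <-> u < ydir A x.
Proof.
move=> u0; rewrite ydir_gtP ?(ltW u0)//; split; last first.
  by move=> [v uv]; apply: dilate_antimono => //; exact: ltW.
move=> /(dilateE _ u0) Aux.
have : \forall v \near u, rset A (v^-1 *: x).
  have : (fun v : R => v^-1 *: x) @ u --> u^-1 *: x.
    apply: cvgZ; last exact: cvg_cst.
    by apply: cvgV; rewrite ?gt_eqF//; exact: cvg_id.
  by apply; apply: open_nbhs_nbhs; split => //; exact: rset_open.
move=> /nbhs_ballP[e /= e0 ue]; exists (u + e / 2).
  by rewrite ltrDl divr_gt0.
apply/dilateE; first by rewrite addr_gt0// divr_gt0.
apply: ue; rewrite -ball_normE /ball_/= opprD addNKr normrN gtr0_norm ?divr_gt0//.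
by rewrite ltr_pdivrMr// ltr_pMr// ltr1n.
Qed.

(** Increasing [A] makes the gauge monotone along the positive orthant. *)
Lemma ydir_mono x a : (forall k, 0 <= a 0 k) -> ydir A x <= ydir A (x + a).
Proof.
move=> a0; rewrite leNgt; apply/negP => /midf_lt[xau ux].
set u := _ / 2 in xau ux; have u0 : 0 < u := le_lt_trans (ydir_ge0 _ _) xau.
move: ux => /(dilate_ydir _ u0)/(dilateE _ u0) Aux.
suff /(dilateE _ u0)/(dilate_ydir _ u0) : rset A (u^-1 *: (x + a)).
  by rewrite ltNge (ltW xau).
rewrite scalerDr; apply: rset_increasing => // k.
by rewrite mxE mulr_ge0// invr_ge0 ltW.
Qed.

(** This is the triangle inequality for the Minkowski functional of the convex
    complement: if [x / s] and [y / t] lie outside [A], then so does their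
    convex combination [(x + y) / (s + t)]. *)
Lemma ydir_subadd x y : ydir A (x + y) <= ydir A x + ydir A y.
Proof.
rewrite leNgt; apply/negP => lt.
pose e := (ydir A (x + y) - (ydir A x + ydir A y)) / 3.
have e0 : 0 < e by rewrite divr_gt0// subr_gt0.
pose s := ydir A x + e; pose t := ydir A y + e.
have s0 : 0 < s by rewrite ltr_wpDl ?ydir_ge0.
have t0 : 0 < t by rewrite ltr_wpDl ?ydir_ge0.
have st0 : 0 < s + t by rewrite addr_gt0.
have : s + t < ydir A (x + y) by rewrite /s /t /e; lra.
move=> /(dilate_ydir _ st0)/(dilateE _ st0).
have nAx : ~ rset A (s^-1 *: x).
  by move/(dilateE _ s0)/(dilate_ydir _ s0); rewrite /s ltNge lerDl ltW.
have nAy : ~ rset A (t^-1 *: y).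
  by move/(dilateE _ t0)/(dilate_ydir _ t0); rewrite /t ltNge lerDl ltW.
have c01 : 0 <= s / (s + t) <= 1.
  by rewrite divr_ge0 ?(ltW s0) ?(ltW st0)//= ler_pdivrMr// mul1r lerDl ltW.
have := complement_convex c01 nAx nAy.
have -> : 1 - s / (s + t) = t / (s + t) by field; rewrite gt_eqF.
rewrite !scalerA scalerDr [s / _]mulrC [t / _]mulrC !mulfK ?gt_eqF//; exact.
Qed.

Lemma ydir0 : ydir A 0 = 0.
Proof.
apply/eqP; rewrite eq_le ydir_ge0 andbT leNgt; apply/negP => A0.
have [u u0 /(dilateE _ u0)] := (ydir_gtP A 0 (lexx 0)).1 A0.
rewrite scaler0 => ?; apply: (@rset_closure0 _ _ A); exact: subset_closure.
Qed.

Lemma ydir_sum_le (I : Type) (r : seq I) (v : I -> 'rV[R]_d) :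
  ydir A (\sum_(i <- r) v i) <= \sum_(i <- r) ydir A (v i).
Proof.
elim: r => [|i r IH]; first by rewrite !big_nil ydir0.
by rewrite !big_cons; apply: (le_trans (ydir_subadd _ _)); rewrite lerD2l.
Qed.

Lemma ydir_le_sum (I : finType) (v : I -> 'rV[R]_d) (i : I) :
  (forall j k, 0 <= v j 0 k) -> ydir A (v i) <= ydir A (\sum_j v j).
Proof.
move=> v0; rewrite (bigD1 i)//=; apply: ydir_mono => k.
by rewrite summxE sumr_ge0.
Qed.

End gauge.

(** * Measurability and union bounds *)

Section measurable_events.
Context {R : realType} {disp} {T : measurableType disp}.

Lemma measurable_exceed (f : T -> R) x : measurable_fun setT f ->
  measurable [set w | x < f w].
Proof.
move=> mf; rewrite -[X in measurable X]setTI.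
rewrite (_ : [set w | _] = f @^-1` `]x, +oo[); first exact: mf.
by apply/seteqP; split=> w /=; rewrite in_itv/= andbT.
Qed.

Lemma measurable_not_exceed (f : T -> R) x : measurable_fun setT f ->
  measurable [set w | f w <= x].
Proof.
move=> mf; rewrite (_ : [set w | _] = ~` [set w | x < f w]).
  by apply: measurableC; exact: measurable_exceed.
by apply/seteqP; split=> w /=; rewrite leNgt => /negP.
Qed.

Lemma measurable_below (f : T -> R) x : measurable_fun setT f ->
  measurable [set w | f w < x].
Proof.
move=> mf; rewrite (_ : [set w | _] = [set w | - x < - f w]).
  by apply: measurable_exceed; exact: measurableT_comp.
by apply/seteqP; split=> w /=; rewrite ltrN2.
Qed.

Lemma measurable_band (f : T -> R) a b :
  measurable_fun setT f -> measurable [set w | a <= f w < b].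
Proof.
move=> mf; rewrite (_ : [set w | _] = ~` [set w | f w < a] `&` [set w | f w < b]).
  by apply: measurableI; [apply: measurableC|]; exact: measurable_below.
apply/seteqP; split=> w /=; first by rewrite leNgt => /andP[/negP].
by move=> [/negP wa ->]; rewrite leNgt wa.
Qed.

Lemma measurable_forall (I : countType) (E : I -> set T) :
  (forall i, measurable (E i)) -> measurable [set w | forall i, E i w].
Proof.
move=> mE; rewrite (_ : [set w | _] = \bigcap_i E i).
  rewrite -[X in measurable X]setCK setC_bigcap; apply: measurableC.
  by apply: countable_bigcupT_measurable => // i; exact: measurableC.
by apply/seteqP; split=> w /= Ew i => [_|]; exact: Ew.
Qed.

End measurable_events.

Section prob_theory.
Context {R : realType} {disp} {T : measurableType disp} (P : probability T R).

Lemma probE (E : set T) : measurable E -> P E = (prob P E)%:E.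
Proof. by move=> mE; rewrite /prob fineK// fin_num_measure. Qed.

Lemma prob_ge0 (E : set T) : 0 <= prob P E.
Proof. by rewrite /prob fine_ge0. Qed.

Lemma prob_le1 (E : set T) : measurable E -> prob P E <= 1.
Proof. by move=> mE; rewrite -lee_fin -probE// probability_le1. Qed.

Lemma le_prob (E F : set T) : measurable E -> measurable F ->
  E `<=` F -> prob P E <= prob P F.
Proof. by move=> mE mF EF; rewrite -lee_fin -!probE// le_measure// inE. Qed.

Lemma probU_le (E F G : set T) : measurable E -> measurable F ->
  measurable G -> E `<=` F `|` G -> prob P E <= prob P F + prob P G.
Proof.
move=> mE mF mG EFG; rewrite -lee_fin EFinD -!probE//.
apply: le_trans (measureU2 _ mF mG).
by rewrite le_measure ?inE//; exact: measurableU.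
Qed.

Lemma prob_bigcup_le (I : finType) (p : pred I) (E : set T) (F : I -> set T) :
  measurable E -> (forall i, measurable (F i)) ->
  (forall w, E w -> exists2 i, p i & F i w) ->
  prob P E <= \sum_(i | p i) prob P (F i).
Proof.
move=> mE mF EF.
have mU (r : seq I) : measurable (\big[setU/set0]_(i <- r | p i) F i).
  exact: bigsetU_measurable.
apply: (@le_trans _ _ (prob P (\big[setU/set0]_(i | p i) F i))).
  by apply: le_prob => // w /EF[i pi Fiw]; rewrite (bigD1 i)//=; left.
elim: index_enum => [|i r IH]; first by rewrite !big_nil /prob measure0.
rewrite !big_cons; case: ifP => // _; apply: (le_trans _ (lerD (lexx _) IH)).
by apply: probU_le => //; exact: measurableU.
Qed.

Lemma prob_addU3_le (A B C E : set T) :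
  measurable A -> measurable B -> measurable C -> measurable E ->
  A `&` B = set0 -> A `&` C = set0 -> B `&` C = set0 ->
  A `<=` E -> B `<=` E -> C `<=` E -> prob P A + prob P B + prob P C <= prob P E.
Proof.
move=> mA mB mC mE AB AC BC AE BE CE.
have mAB := measurableU _ _ mA mB.
rewrite -lee_fin !EFinD -!probE// -measureU// -measureU//; last first.
  by rewrite setIUl AC BC setU0.
rewrite le_measure ?inE//; first exact: measurableU.
by move=> z [[/AE|/BE]|/CE].
Qed.

End prob_theory.

(** A Bonferroni inequality: once the overlaps with the other events are
    removed, the events are disjoint. *)
Lemma prob_bigcup_ge {R : realType} {disp} {T : measurableType disp}
    (P : probability T R) n (E : set T) (F : 'I_n -> set T) :
  measurable E -> (forall i, measurable (F i)) -> (forall i, F i `<=` E) ->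
  \sum_i prob P (F i) <=
    prob P E + \sum_i \sum_(j | j != i) prob P (F i `&` F j).
Proof.
move=> mE mF FE.
pose F' i := F i `\` \big[setU/set0]_(j | j != i) F j.
have mU i : measurable (\big[setU/set0]_(j | j != i) F j).
  exact: bigsetU_measurable.
have mF' i : measurable (F' i) by exact: measurableD.
have F'E : \sum_i prob P (F' i) <= prob P E.
  rewrite -lee_fin -sumEFin; under eq_bigr do rewrite -probE//.
  rewrite -measure_bigsetU_ord//; last first.
    move=> i j _ _ [w [[Fi nFi] [Fj _]]]; apply/eqP; apply: contrapT => /negP ij.
    by apply: nFi; rewrite (bigD1 j) 1?eq_sym//=; left.
  rewrite -probE// le_measure// ?inE//; first exact: bigsetU_measurable.
  elim/big_ind: _ => [//|B C BE CE w [/BE|/CE]//|i _ w [/FE]//].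
apply: le_trans (lerD F'E (lexx _)); rewrite -big_split/=.
apply: ler_sum => i _.
have FiFj j : measurable (F i `&` F j) by exact: measurableI.
apply: (@le_trans _ _ (prob P (F' i) +
    prob P (F i `&` \big[setU/set0]_(j | j != i) F j))).
  apply: probU_le => //; first exact: measurableI.
  by move=> w Fiw; rewrite /F'; have [?|?] :=
    pselect ((\big[setU/set0]_(j | j != i) F j) w); [right|left].
rewrite lerD2l; apply: prob_bigcup_le => //; first exact: measurableI.
move=> w [Fiw]; rewrite -bigcup_seq_cond/= => -[j /= ].
by move=> /andP[_ ji] Fj; exists j.
Qed.

(** * Sums that are as large as their largest term *)

Section sums_with_negligible_overlaps.
Context {R : realType} {disp} {T : measurableType disp} (P : probability T R).
Variables (n : nat) (Y : 'I_n -> T -> R) (S : T -> R).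
Hypothesis mY : forall i, measurable_fun setT (Y i).

Definition exceedance i x : set T := [set w | x < Y i w].

Definition sum_tails x : R := \sum_i prob P (exceedance i x).

Lemma measurable_exceedance i x : measurable (exceedance i x).
Proof. exact: measurable_exceed. Qed.

Lemma measurable_remainder x h :
  measurable [set w | x < \sum_i Y i w /\ forall i, Y i w <= x - h].
Proof.
apply: measurableI; first by apply: measurable_exceed; exact: measurable_sum.
by apply: measurable_forall => i; exact: measurable_not_exceed.
Qed.

(** Below, one of the events [Y i > x] forces [S > x], and by [prob_bigcup_ge]
    their probabilities add up to within the overlaps. Above, [S > x] either
    forces some [Y i > x - h x], or happens in the remainder event, where no
    single term does the work; [h] is left free because its size depends on how fast
    the tails vary. *)
Lemma sum_tails_asymp_equiv :
  measurable_fun setT S ->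
  (forall i w, Y i w <= S w) -> (forall w, S w <= \sum_i Y i w) ->
  (forall x, 0 <= x -> 0 < sum_tails x) ->
  (forall e : R, 0 < e -> forall i j, i != j -> \forall x \near +oo,
    prob P (exceedance i x `&` exceedance j x) <= e * sum_tails x) ->
  (forall e : R, 0 < e -> exists h : R -> R, \forall x \near +oo,
    \sum_i prob P (exceedance i (x - h x)) <= (1 + e) * sum_tails x /\
    prob P [set w | x < \sum_i Y i w /\ forall i, Y i w <= x - h x]
      <= e * sum_tails x) ->
  asymp_equiv (fun x => prob P [set w | x < S w]) sum_tails.
Proof.
move=> mS YS SY G0 overlap remainder; apply/cvgrPdist_le => /= e e0.
have [h hE] := remainder (e / 2) (divr_gt0 e0 (ltr0n _ 2)).
(* There are at most [n * n] overlaps. *)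
pose e' : R := e / (n * n).+1%:R.
have e'0 : 0 < e' by rewrite divr_gt0.
have ov : \forall x \near +oo, forall ij : 'I_n * 'I_n, ij.1 != ij.2 ->
    prob P (exceedance ij.1 x `&` exceedance ij.2 x) <= e' * sum_tails x.
  apply: filter_forall => -[i j] /=; have [->|ij] := eqVneq i j.
    by apply: nearW.
  by near do move=> _; exact: overlap.
near=> x.
have Gx : 0 < sum_tails x by apply: G0; near: x; exact: nbhs_pinfty_ge.
have mE y := fun i => measurable_exceedance i y.
rewrite ler_distlC; apply/andP; split.
  rewrite ler_pdivlMr//.
  have := @prob_bigcup_ge _ _ _ P n _ (exceedance^~ x) (measurable_exceed x mS)
    (mE x) (fun i w Yi => lt_le_trans Yi (YS i w)).
  rewrite -/(sum_tails x) => H.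
  suff : \sum_i \sum_(j | j != i) prob P (exceedance i x `&` exceedance j x)
      <= e * sum_tails x by move: H; lra.
  apply: (@le_trans _ _ (\sum_(i < n) \sum_(j < n) e' * sum_tails x)).
    apply: ler_sum => i _; rewrite big_mkcond/=; apply: ler_sum => j _.
    case: ifPn => [ji|_]; last by rewrite mulr_ge0// ltW.
    by apply: (near ov x _ (i, j)) => //=; rewrite eq_sym.
  rewrite !sumr_const !card_ord -mulrnA -mulr_natl mulrA ler_pM2r//.
  rewrite /e' mulrCA ler_piMr ?ltW// ltr_pdivrMr// mul1r ltr_nat.
  by [].
rewrite ler_pdivrMr//.
have [h1 h2] : \sum_i prob P (exceedance i (x - h x)) <= (1 + e / 2) * sum_tails x /\
    prob P [set w | x < \sum_i Y i w /\ forall i, Y i w <= x - h x]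
      <= e / 2 * sum_tails x by near: x.
have mB := measurable_remainder x (h x).
apply: le_trans (_ : (1 + e / 2) * sum_tails x + e / 2 * sum_tails x <= _); last by lra.
apply: le_trans (lerD h1 h2).
have mU : measurable (\bigcup_i exceedance i (x - h x)).
  exact: countable_bigcupT_measurable.
apply: (@le_trans _ _ (prob P (\bigcup_i exceedance i (x - h x)) +
    prob P [set w | x < \sum_i Y i w /\ forall i, Y i w <= x - h x])).
  apply: probU_le => //; first exact: measurable_exceed.
  move=> w /= xS; have [[i Yi]|noY] := pselect (exists i, x - h x < Y i w).
    by left; exists i.
  right; split; first exact: lt_le_trans xS (SY w).
  by move=> i; rewrite leNgt; apply/negP => Yi; apply: noY; exists i.
rewrite lerD2r; apply: prob_bigcup_le => //.
by move=> w [i _ Yi]; exists i.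
Unshelve. all: by end_near. Qed.

End sums_with_negligible_overlaps.

(** * The tail classes in terms of inequalities at infinity *)

Section tail_classes.
Context {R : realType}.
Implicit Types V : probability R R.

Lemma near_pinfty_scale (c : R) (Q : R -> Prop) : 0 < c ->
  (\forall x \near +oo, Q x) -> \forall x \near +oo, Q (c * x).
Proof.
move=> c0 [M [Mr MQ]]; exists (c^-1 * M); split; first exact: num_real.
by move=> x; rewrite ltr_pdivrMl// => ?; exact: MQ.
Qed.

Lemma near_pinfty_shift (y : R) (Q : R -> Prop) :
  (\forall x \near +oo, Q x) -> \forall x \near +oo, Q (x - y).
Proof.
move=> [M [Mr MQ]]; exists (M + y); split; first exact: num_real.
by move=> x; rewrite -ltrBrDr => ?; exact: MQ.
Qed.

Lemma limsup_tail_lt V b (c : R) : halfline_dist V ->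
  (limsup_tail V b < c%:E)%E ->
  \forall x \near +oo, tail V (b * x) <= c * tail V x.
Proof.
move=> [_ V0] /ereal_inf_lt[_ [B Boo <-] Bc].
near=> x.
have Vx : 0 < tail V x by apply: V0; near: x; exact: nbhs_pinfty_ge.
rewrite -ler_pdivrMr// -lee_fin; apply/ltW/(le_lt_trans _ Bc).
by apply: ereal_sup_ubound; exists x => //; near: x.
Unshelve. all: by end_near. Qed.

Lemma class_C_scale V (e : R) : class_C V -> 0 < e ->
  \forall b \near 1^'-, \forall x \near +oo, tail V (b * x) <= (1 + e) * tail V x.
Proof.
move=> [hV /fine_cvgP[fl /cvgr_lt lt]] e0.
have lt1 : (1 : R) < 1 + e by rewrite ltrDl.
near=> b; apply: limsup_tail_lt => //.
have flb : limsup_tail V b \is a fin_num by near: b.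
by rewrite -(fineK flb) lte_fin; near: b; exact: lt.
Unshelve. all: by end_near. Qed.

Lemma class_D_scale V b : class_D V -> 0 < b < 1 ->
  exists K, \forall x \near +oo, tail V (b * x) <= K * tail V x.
Proof.
move=> [hV /(_ b)/[apply] /ereal_inf_lt[y yin ylt]].
have [c yc] : exists c, (y < c%:E)%E.
  case: y ylt {yin} => [r _|//|_]; last by exists 0; rewrite ltNyr.
  by exists (r + 1); rewrite lte_fin ltrDl.
exists c; apply: limsup_tail_lt => //.
by rewrite /limsup_tail limf_esupE; apply/ereal_inf_ltP; exists y.
Qed.

Lemma class_L_shift V (e y : R) : class_L V -> 0 < e -> 0 <= y ->
  \forall x \near +oo, tail V (x - y) <= (1 + e) * tail V x.
Proof.
move=> [[_ V0] L] e0; rewrite le_eqVlt => /predU1P[<-|y0].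
  near=> x; rewrite subr0 ler_peMl ?lerDl ?(ltW e0)//.
  by apply/ltW/V0; near: x; exact: nbhs_pinfty_ge.
have /cvgr_lt lt := L y y0.
have lt1 : (1 : R) < 1 + e by rewrite ltrDl.
near=> x.
have Vx : 0 < tail V x by apply: V0; near: x; exact: nbhs_pinfty_ge.
by rewrite -ler_pdivrMr//; apply/ltW; near: x; exact: lt.
Unshelve. all: by end_near. Qed.

End tail_classes.

(** * Two large terms under bivariate asymptotic independence *)

(** If a sum exceeds [x] although no term exceeds [x - h], then the largest
    term is above its average share, and the others still have to supply [h]. *)
Lemma two_large_terms {R : realType} n (a : 'I_n -> R) (x h : R) : 0 <= x -> 0 <= h ->
  x < \sum_i a i -> (forall i, a i <= x - h) ->
  exists k j, [/\ k != j, x / n%:R < a k & h / n%:R < a j].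
Proof.
move=> x0 h0 xa ah.
have n0 : (0 < n)%N.
  by case: n a xa {ah} => // a; rewrite big_ord0 ltNge x0.
have n0R : (0 : R) < n%:R by rewrite ltr0n.
have [k xk] : exists k, x / n%:R < a k.
  apply: contrapT => /forallNP ak; move: xa; rewrite ltNge => /negP; apply.
  apply: (@le_trans _ _ (\sum_(i < n) x / n%:R)).
    by apply: ler_sum => i _; rewrite leNgt; exact/negP.
  by rewrite sumr_const card_ord -[_ *+ n]mulr_natr divfK// gt_eqF.
suff [j kj hj] : exists2 j, j != k & h / n%:R < a j.
  by exists k, j; split=> //; rewrite eq_sym.
apply: contrapT => /forall2NP aj.
move: xa; rewrite ltNge => /negP; apply; rewrite (bigD1 k)//=.
suff : \sum_(i < n | i != k) a i <= h by have := ah k; lra.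
apply: (@le_trans _ _ (\sum_(i < n) h / n%:R)); last first.
  by rewrite sumr_const card_ord -[_ *+ n]mulr_natr divfK// gt_eqF.
rewrite [leRHS](bigD1 k)//= -[leLHS]add0r lerD//; first by rewrite divr_ge0.
by apply: ler_sum => i ik; have [|/negP] := aj i; rewrite ?ik// -leNgt.
Qed.

Section small_remainder.
Context {R : realType} {disp} {T : measurableType disp} (P : probability T R).
Variables (n : nat) (Y : 'I_n -> T -> R).
Hypothesis n_gt0 : (0 < n)%N.
Hypothesis mY : forall i, measurable_fun setT (Y i).
Variable V : 'I_n -> probability R R.
Hypothesis VE : forall i x, tail (V i) x = prob P (exceedance Y i x).
Hypothesis hV : forall i, halfline_dist (V i).

Local Notation G := (sum_tails P Y).
Local Notation exceed i x := (exceedance Y i x).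

Lemma sum_tails_gt0 x : 0 <= x -> 0 < G x.
Proof.
move=> x0; rewrite /sum_tails (bigD1 (Ordinal n_gt0))//= ltr_wpDr//.
  by apply: sumr_ge0 => i _; exact: prob_ge0.
by rewrite -VE; apply: (hV _).2.
Qed.

Lemma sum_tails_ge0 x : 0 <= G x.
Proof. by apply: sumr_ge0 => i _; exact: prob_ge0. Qed.

Lemma prob_exceed_le i x : prob P (exceed i x) <= G x.
Proof.
rewrite /sum_tails (bigD1 i)//= lerDl.
by apply: sumr_ge0 => j _; exact: prob_ge0.
Qed.

Lemma le_exceed i x y : y <= x -> exceed i x `<=` exceed i y.
Proof. by move=> yx w /=; exact: le_lt_trans. Qed.

Lemma measurable_overlap i j x y : measurable (exceed i x `&` exceed j y).
Proof. by apply: measurableI; exact: measurable_exceedance. Qed.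

Lemma le_sum_tails x y : y <= x -> G x <= G y.
Proof.
move=> yx; apply: ler_sum => i _; apply: le_prob; last exact: le_exceed.
all: exact: measurable_exceedance.
Qed.

Lemma near_sum_tails (g : R -> R) (K : R) :
  (forall i, \forall x \near +oo, tail (V i) (g x) <= K * tail (V i) x) ->
  \forall x \near +oo, G (g x) <= K * G x.
Proof.
move=> /filter_forall; apply: filterS => x VK.
by rewrite /sum_tails mulr_sumr; apply: ler_sum => i _; rewrite -!VE.
Qed.

Lemma prob_remainder_le x h : 0 <= x -> 0 <= h ->
  prob P [set w | x < \sum_i Y i w /\ forall i, Y i w <= x - h] <=
  \sum_(ij : 'I_n * 'I_n | ij.1 != ij.2)
     prob P (exceed ij.1 (x / n%:R) `&` exceed ij.2 (h / n%:R)).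
Proof.
move=> x0 h0; apply: prob_bigcup_le.
- exact: measurable_remainder.
- by move=> ij; exact: measurable_overlap.
move=> w [xY Yh]; have [k [j [kj xk hj]]] := two_large_terms x0 h0 xY Yh.
by exists (k, j).
Qed.

Lemma sum_pairs_le (f : 'I_n * 'I_n -> R) (e c : R) : 0 <= e -> 0 <= c ->
  (forall ij, ij.1 != ij.2 -> f ij <= e / (n * n).+1%:R * c) ->
  \sum_(ij : 'I_n * 'I_n | ij.1 != ij.2) f ij <= e * c.
Proof.
move=> e0 c0 fe; have ec0 : 0 <= e / (n * n).+1%:R * c.
  by rewrite mulr_ge0// divr_ge0.
apply: (@le_trans _ _ (\sum_(ij : 'I_n * 'I_n) e / (n * n).+1%:R * c)).
  rewrite big_mkcond/=; apply: ler_sum => ij _.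
  by case: ifPn => // /fe.
rewrite sumr_const card_prod !card_ord -[_ *+ (n * n)]mulr_natl mulrA ler_wpM2r//.
by rewrite mulrCA ler_piMr// ler_pdivrMr// mul1r ler_nat.
Qed.

(** ** Consistent variation and quasi asymptotic independence *)

Section consistent_variation.
Hypothesis CV : forall i, class_C (V i).

Lemma sum_tails_near_scale (e : R) : 0 < e ->
  exists2 b : R, 0 < b < 1 & \forall x \near +oo, G (b * x) <= (1 + e) * G x.
Proof.
move=> e0.
have : \forall b \near (1 : R)^'-, forall i,
    \forall x \near +oo, tail (V i) (b * x) <= (1 + e) * tail (V i) x.
  by apply: filter_forall => i; exact: class_C_scale.
move=> H; near (1 : R)^'- => b; exists b.
  apply/andP; split; near: b; first exact: nbhs_left_gt.
  exact: nbhs_left_lt.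
by apply: (near_sum_tails (g := *%R b)); near: b.
Unshelve. all: by end_near. Qed.

(** Consistent variation implies dominated variation: iterate a scaling by
    some [b < 1] which costs at most a factor 2 until [b ^+ k <= c]. *)
Lemma sum_tails_C_dominated (c : R) : 0 < c ->
  exists2 K : R, 0 < K & \forall x \near +oo, G (c * x) <= K * G x.
Proof.
move=> c0; have [b /andP[b0 b1] Gb] := sum_tails_near_scale ltr01.
have Gbk k : \forall x \near +oo, G (b ^+ k * x) <= (1 + 1) ^+ k * G x.
  elim: k => [|k IH]; first by apply: nearW => x; rewrite !expr0 !mul1r.
  near=> x; rewrite exprS -mulrA.
  apply: (@le_trans _ _ ((1 + 1) * G (b ^+ k * x))).
    near: x; apply: (near_pinfty_scale (Q := fun x => G (b * x) <= (1 + 1) * G x)) => //.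
    exact: exprn_gt0.
  by rewrite exprS -mulrA ler_pM2l//; near: x.
have [k bk] : exists k, b ^+ k <= c.
  have b1' : `|b| < 1 by rewrite gtr0_norm.
  have /cvgr_lt/(_ _ c0)[k _ kc] := cvg_expr b1'.
  by exists k; apply/ltW/(kc k)/leqnn.
exists ((1 + 1) ^+ k); first by rewrite exprn_gt0.
near=> x; apply: (@le_trans _ _ (G (b ^+ k * x))); last by near: x.
apply: le_sum_tails; rewrite ler_wpM2r//; near: x; exact: nbhs_pinfty_ge.
Unshelve. all: by end_near. Qed.

Lemma QAI_overlap_le (e : R) i j : QAI P Y -> 0 < e -> i != j ->
  \forall x \near +oo, prob P (exceed i x `&` exceed j x) <= e * G x.
Proof.
move=> qai e0 ij; have /cvgr_lt/(_ _ e0) lt := qai i j ij; near=> x.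
have x0 : 0 <= x by near: x; exact: nbhs_pinfty_ge.
have ij0 : 0 < prob P (exceed i x) + prob P (exceed j x).
  by rewrite addr_gt0 -?VE//; apply: (hV _).2.
apply: (@le_trans _ _ (e * (prob P (exceed i x) + prob P (exceed j x)))).
  by rewrite -ler_pdivrMr//; apply/ltW; near: x.
have ji : j != i by rewrite eq_sym.
rewrite ler_pM2l// /sum_tails (bigD1 i)//= (bigD1 j)//= addrA lerDl.
by apply: sumr_ge0 => k _; exact: prob_ge0.
Unshelve. all: by end_near. Qed.

(** The allowance [(1 - b) x] grows like [x], so both terms supplied by
    [two_large_terms] exceed a fixed multiple [c x]; the overlap at [c x] is
    negligible against the tails at [c x], which dominated variation compares
    with the tails at [x]. *)
Lemma QAI_remainder_le (e : R) : QAI P Y -> 0 < e ->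
  exists h : R -> R, \forall x \near +oo,
    \sum_i prob P (exceed i (x - h x)) <= (1 + e) * G x /\
    prob P [set w | x < \sum_i Y i w /\ forall i, Y i w <= x - h x]
      <= e * G x.
Proof.
move=> qai e0; have [b /andP[b0 b1] Gb] := sum_tails_near_scale e0.
have n0 : (0 : R) < n%:R by rewrite ltr0n.
pose c : R := (1 - b) / n%:R.
have c0 : 0 < c by rewrite divr_gt0// subr_gt0.
have [K K0 GK] := sum_tails_C_dominated c0.
exists (fun x => (1 - b) * x); near=> x.
have x0 : 0 <= x by near: x; exact: nbhs_pinfty_ge.
split.
  by rewrite (_ : x - _ = b * x) -?/(sum_tails _ _ _); [near: x|ring].
apply: le_trans (prob_remainder_le x0 _) _.
  by rewrite mulr_ge0// subr_ge0 ltW.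
apply: sum_pairs_le; [exact: ltW|exact: sum_tails_ge0|move=> [i j] /= ij].
have -> : (1 - b) * x / n%:R = c * x by rewrite /c; ring.
apply: (@le_trans _ _ (prob P (exceed i (c * x) `&` exceed j (c * x)))).
  apply: le_prob; [exact: measurable_overlap|exact: measurable_overlap|].
  apply: setSI; apply: le_exceed; rewrite mulrC ler_wpM2l//.
  by rewrite ler_piMl ?invr_ge0 ?(ltW n0)// lerBlDr lerDl ltW.
apply: (@le_trans _ _ (e / (n * n).+1%:R / K * G (c * x))); last first.
  rewrite -mulrA ler_pM2l ?divr_gt0// ler_pdivrMl//.
  by near: x.
move: i j ij.
suff : forall ij : 'I_n * 'I_n, ij.1 != ij.2 ->
    prob P (exceed ij.1 (c * x) `&` exceed ij.2 (c * x)) <=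
    e / (n * n).+1%:R / K * G (c * x) by move=> H i j; exact: (H (i, j)).
near: x; apply: (near_pinfty_scale (Q := fun x => forall ij : 'I_n * 'I_n,
  ij.1 != ij.2 -> prob P (exceed ij.1 x `&` exceed ij.2 x) <=
    e / (n * n).+1%:R / K * G x)) => //.
apply: filter_forall => -[i j] /=; have [->|ij] := eqVneq i j; first exact: nearW.
have e'0 : 0 < e / (n * n).+1%:R / K by rewrite !divr_gt0.
by apply: filterS (QAI_overlap_le qai e'0 ij) => y + _.
Unshelve. all: by end_near. Qed.

End consistent_variation.

(** ** Long, dominatedly varying tails and tail asymptotic independence *)

Section long_tails.

Lemma sum_tails_near_shift (e y : R) : (forall i, class_L (V i)) ->
  0 < e -> 0 <= y -> \forall x \near +oo, G (x - y) <= (1 + e) * G x.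
Proof.
move=> LV e0 y0.
by apply: (near_sum_tails (g := fun x => x - y)) => i; exact: class_L_shift.
Qed.

Lemma sum_tails_D_dominated (c : R) : (forall i, class_D (V i)) -> 0 < c <= 1 ->
  exists2 K : R, 0 < K & \forall x \near +oo, G (c * x) <= K * G x.
Proof.
move=> DV /andP[c0]; rewrite le_eqVlt => /predU1P[->|c1].
  by exists 1 => //; apply: nearW => x; rewrite !mul1r.
have c01 : 0 < c < 1 by rewrite c0.
have /choice[K VK] := fun i => class_D_scale (DV i) c01.
exists (1 + \sum_i `|K i|); first by rewrite ltr_wpDr// sumr_ge0.
apply: (near_sum_tails (g := *%R c)) => i; apply: filterS (VK i) => x.
move=> /le_trans; apply; apply: ler_wpM2r; first by rewrite VE prob_ge0.
apply: le_trans (ler_norm _) _; rewrite (bigD1 i)//= addrCA lerDl.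
by rewrite addr_ge0// sumr_ge0.
Qed.

Lemma TAI_near (e : R) : TAI P Y -> 0 < e -> exists2 M : R, 0 <= M &
  forall i j x y, i != j -> M < x -> M < y ->
    prob P (exceed i x `&` exceed j y) <= e * prob P (exceed j y).
Proof.
move=> tai e0.
have H (ij : 'I_n * 'I_n) : exists M : R, ij.1 != ij.2 -> forall x y,
    M < x -> M < y ->
    prob P (exceed ij.1 x `&` exceed ij.2 y) <= e * prob P (exceed ij.2 y).
  case: ij => i j /=; have [->|ij] := eqVneq i j; first by exists 0.
  have /cvgr_lt/(_ _ e0)[[A B] /= [[a [_ Aa]] [b [_ Bb]]] AB] := tai i j ij.
  exists (Num.max 0 (Num.max a b)) => _ x y.
  rewrite !gt_max => /and3P[x0 ax _] /and3P[y0 _ bY].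
  rewrite -ler_pdivrMr; last by rewrite -VE; apply: (hV _).2; exact: ltW.
  by apply/ltW; apply: (AB (x, y)); split; [exact: Aa|exact: Bb].
have [M HM] := choice H; exists (\sum_ij `|M ij|); first by rewrite sumr_ge0.
have Mle ij : M ij <= \sum_ij `|M ij|.
  by rewrite (bigD1 ij)//=; apply: le_trans (ler_norm _) _; rewrite lerDl sumr_ge0.
by move=> i j x y ij xM yM; apply: (HM (i, j)) => //=; exact: le_lt_trans (Mle _) _.
Qed.

Lemma TAI_overlap_le (e : R) i j : TAI P Y -> 0 < e -> i != j ->
  \forall x \near +oo, prob P (exceed i x `&` exceed j x) <= e * G x.
Proof.
move=> tai e0 ij; have [M M0 tM] := TAI_near tai e0; near=> x.
have Mx : M < x by near: x; apply: nbhs_pinfty_gt; exact: num_real.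
apply: le_trans (tM i j x x ij Mx Mx) _.
by rewrite ler_pM2l//; exact: prob_exceed_le.
Unshelve. all: by end_near. Qed.

(** A constant allowance [n (M + 1)] is enough here: tail asymptotic
    independence already takes effect when the smaller of the two terms is
    above the fixed level [M], and long tails absorb a constant shift. *)
Lemma TAI_remainder_le (e : R) : TAI P Y -> (forall i, class_DL (V i)) ->
  0 < e -> exists h : R -> R, \forall x \near +oo,
    \sum_i prob P (exceed i (x - h x)) <= (1 + e) * G x /\
    prob P [set w | x < \sum_i Y i w /\ forall i, Y i w <= x - h x]
      <= e * G x.
Proof.
move=> tai DLV e0.
have n0 : (0 : R) < n%:R by rewrite ltr0n.
have c01 : 0 < (n%:R^-1 : R) <= 1 by rewrite invr_gt0 n0 invf_le1// ler1n.
have [K K0 GK] := sum_tails_D_dominated (fun i => (DLV i).1) c01.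
have e'0 : 0 < e / (n * n).+1%:R / K by rewrite !divr_gt0.
have [M M0 tM] := TAI_near tai e'0.
have h0 : 0 <= n%:R * (M + 1) by rewrite mulr_ge0 ?ltW// ltr_wpDl.
exists (fun=> n%:R * (M + 1)); near=> x.
have x0 : 0 <= x by near: x; exact: nbhs_pinfty_ge.
have nMx : n%:R * M < x by near: x; apply: nbhs_pinfty_gt; exact: num_real.
split.
  rewrite -/(sum_tails _ _ _); near: x.
  by apply: sum_tails_near_shift => // i; exact: (DLV i).2.
apply: le_trans (prob_remainder_le x0 h0) _.
apply: sum_pairs_le; [exact: ltW|exact: sum_tails_ge0|move=> [i j] /= ij].
rewrite mulrAC divff ?gt_eqF// mul1r setIC.
apply: (@le_trans _ _ (e / (n * n).+1%:R / K * prob P (exceed i (x / n%:R)))).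
  apply: tM; [by rewrite eq_sym|by rewrite ltrDl|].
  by rewrite ltr_pdivlMr// mulrC.
apply: (@le_trans _ _ (e / (n * n).+1%:R / K * G (n%:R^-1 * x))).
  by rewrite ler_pM2l// mulrC; exact: prob_exceed_le.
rewrite -mulrA ler_pM2l ?divr_gt0// ler_pdivrMl//; near: x; exact: GK.
Unshelve. all: by end_near. Qed.

End long_tails.
End small_remainder.

(** * Pairs of independent large variables *)

Section product_measures.
Context {R : realType} {disp} {T : measurableType disp} (P : probability T R).

Lemma product_measure_ysectionE (W : probability R R) (E : set (T * R)) :
  measurable E -> (P \x W)%E E = (\int[W]_t P (ysection E t))%E.
Proof.
move=> mE; rewrite (@product_measure_unique _ _ _ _ _ P W (P \x^ W)%E)//.
by move=> A B mA mB; exact: product_measure2E.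
Qed.

Lemma prob_rect {disp'} {T' : measurableType disp'} (Q : probability T' R)
    (A : set T) (B : set T') : measurable A -> measurable B ->
  prob (P \x Q)%E (A `*` B) = prob P A * prob Q B.
Proof.
move=> mA mB; apply: EFin_inj; rewrite EFinM -!probE//.
  exact: product_measure1E.
exact: measurableX.
Qed.

End product_measures.

Section independent_large.
Context {R : realType}.
Implicit Types V W H : probability R R.

Definition both_large (L x : R) : set (R * R) :=
  [set z | [/\ L < z.1, L < z.2 & x < z.1 + z.2]].

Lemma measurable_both_large L x : measurable (both_large L x).
Proof.
rewrite (_ : both_large L x = [set z | L < z.1] `&` [set z | L < z.2] `&`
    [set z : R * R | x < z.1 + z.2]); last first.
  by apply/seteqP; split=> z /= => [[]|[[]]].
apply: measurableI; first apply: measurableI.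
- exact: measurable_exceed measurable_fst.
- exact: measurable_exceed measurable_snd.
- exact: measurable_exceed (@measurable_radd R).
Qed.

Lemma xsection_both_large L x t : xsection (both_large L x) t =
  if L < t then `]Num.max L (x - t), +oo[%classic else set0.
Proof.
apply/seteqP; split=> s; rewrite /xsection/= inE.
  move=> [/= -> Ls xs]; rewrite /= in_itv/= andbT gt_max Ls/=.
  by rewrite ltrBlDl.
case: ifP => //= Lt; rewrite in_itv/= andbT gt_max ltrBlDl => /andP[Ls xs].
by split.
Qed.

Lemma ysection_both_large L x t :
  ysection (both_large L x) t = xsection (both_large L x) t.
Proof.
apply/seteqP; split=> s; rewrite /xsection/ysection/= !inE => -[/= ? ? ?].
all: by split=> //=; rewrite addrC.
Qed.

Lemma product_measure_both_largeC V W L x :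
  (V \x W)%E (both_large L x) = (W \x V)%E (both_large L x).
Proof.
rewrite product_measure_ysectionE; last exact: measurable_both_large.
by apply: eq_integral => t _; rewrite /= ysection_both_large.
Qed.

Lemma product_measure_both_large_le V W W' L x :
  (forall t, tail W t <= tail W' t) ->
  ((V \x W) (both_large L x) <= (V \x W') (both_large L x))%E.
Proof.
move=> WW'; have mB := @measurable_both_large L x.
apply: ge0_le_integral => //.
- exact: measurable_fun_xsection.
- exact: measurable_fun_xsection.
move=> t _ /=; rewrite xsection_both_large; case: ifP => _.
  by rewrite !probE// lee_fin; exact: WW'.
by rewrite !measure0.
Qed.

(** Fubini, conditioning on the second coordinate: the section of [E] at [t]
    enters only through its probability, so a bound on it by the tails of the
    [V j] replaces the first coordinate by independent copies of them. *)
Lemma product_measure_le_both_large {disp} {T : measurableType disp}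
    (P : probability T R) W (I : finType) (V : I -> probability R R) (c : R)
    (L x : R) (E : set (T * R)) :
  measurable E -> 0 <= c ->
  (forall t, ysection E t = set0 \/ L < t /\
    (P (ysection E t) <= c%:E * \sum_j V j `](Num.max L (x - t))%R, +oo[%classic)%E) ->
  ((P \x W) E <= c%:E * \sum_j (W \x V j) (both_large L x))%E.
Proof.
move=> mE c0 EV; have mB := @measurable_both_large L x.
have mV j : measurable_fun setT (fun t => V j (xsection (both_large L x) t)).
  exact: measurable_fun_xsection.
rewrite product_measure_ysectionE// -ge0_integral_sum//.
rewrite -ge0_integralZl//; last first.
- by move=> t _; apply: sume_ge0 => j _.
- exact: emeasurable_sum.
apply: ge0_le_integral => //.
- exact: measurable_fun_ysection.
- by apply: measurable_funeM; exact: emeasurable_sum.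
move=> t _; have [->|[Lt]] := EV t.
  by rewrite measure0 mule_ge0// sume_ge0.
move=> /le_trans; apply; rewrite lee_wpmul2l// lee_sum// => j _ /=.
by rewrite xsection_both_large Lt.
Qed.

End independent_large.

Lemma measurable_large_pair {R : realType} {disp} {T : measurableType disp}
    (D : set T) (Z : T -> R) (L x : R) : measurable D -> measurable_fun setT Z ->
  measurable [set z : T * R | [/\ D z.1, L < z.2 & x < Z z.1 + z.2]].
Proof.
move=> mD mZ.
rewrite (_ : [set z | _] = (D `*` setT) `&` [set z | L < z.2] `&`
    [set z : T * R | x < Z z.1 + z.2]); last first.
  by apply/seteqP; split=> z /= => [[]|[[[]]]].
apply: measurableI; first apply: measurableI.
- exact: measurableX.
- exact: measurable_exceed measurable_snd.
- apply: measurable_exceed; apply: measurable_funD => //.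
  exact: (measurableT_comp mZ measurable_fst).
Qed.

Section unit_cells.
Context {R : realType} {disp} {T : measurableType disp} (P : probability T R).

(** The hypothesis compares the joint law of [Z] and [Y] with a product on
    rectangles whose first side is a unit cell. Cutting the range of [Z] into
    such cells covers [Z + Y > x] by rectangles that stay inside
    [Z + Y > x - 1]; the loss of 1 is harmless for long-tailed laws. *)
Lemma prob_sum_le_product (D : set T) (Z Y : T -> R) (W : probability R R)
    (C L x : R) :
  measurable D -> measurable_fun setT Z -> measurable_fun setT Y -> 0 <= C ->
  (forall w, D w -> 0 <= Z w) ->
  (forall a t, L <= t ->
    (P (D `&` [set w | (a <= Z w < a + 1)%R] `&` [set w | (t < Y w)%R]) <=
     C%:E * (P (D `&` [set w | (a <= Z w < a + 1)%R]) * W `]t, +oo[%classic))%E) ->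
  (P (D `&` [set w | (L < Y w)%R /\ (x < Z w + Y w)%R]) <=
   C%:E * (P \x W) [set z | [/\ D z.1, (L < z.2)%R & (x - 1 < Z z.1 + z.2)%R]])%E.
Proof.
move=> mD mZ mY C0 DZ DC.
pose cell (k : nat) := D `&` [set w | k%:R <= Z w < k%:R + 1].
pose level (k : nat) := Num.max L (x - k%:R - 1).
have mcell k : measurable (cell k).
  apply: measurableI => //.
  exact: measurable_band.
have mE := measurable_large_pair L (x - 1) mD mZ.
have mYl t : measurable [set w | t < Y w] by exact: measurable_exceed.
apply: (@le_trans _ _ (\sum_(k <oo) P (cell k `&` [set w | (level k < Y w)%R]))%E).
  apply: (measure_sigma_subadditive P) => //.
  - by move=> k; exact: measurableI.
  - apply: measurableI => //; apply: measurableI; first exact: mYl.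
    exact: measurable_exceed (measurable_funD mZ mY).
  move=> w [Dw [Lw xw]].
  have Zw := truncn_itv (DZ w Dw).
  exists (Num.truncn (Z w)) => //=; split; first by split=> //; rewrite natr1.
  by rewrite /level gt_max Lw; move: Zw xw; rewrite -natr1; lra.
apply: (@le_trans _ _ (\sum_(k <oo)
    C%:E * (P \x W) (cell k `*` `](level k), +oo[))%E).
  apply: lee_nneseries => // k _.
  rewrite product_measure1E//; apply: DC.
  by rewrite /level le_max lexx.
rewrite nneseriesZl// lee_wpmul2l//.
rewrite -measure_semi_bigcup//; last 3 first.
- by move=> k; exact: measurableX.
- move=> i j _ _ [[w t] [[[_ /= wi] _] [[_ /= wj] _]]].
  have <- : Num.truncn (Z w) = i by apply: truncn_def; rewrite -natr1.
  by apply: truncn_def; rewrite -natr1.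
- by apply: bigcup_measurable => k _; exact: measurableX.
rewrite le_measure ?inE//.
  by apply: bigcup_measurable => k _; exact: measurableX.
move=> [w t] [k _ [/= [Dw kw]]]; rewrite in_itv/= andbT /level gt_max.
by move=> /andP[Lt xt]; split => //=; move: kw xt => /= /andP[? ?] ?; lra.
Qed.

End unit_cells.

(** * Subexponential laws *)

Section subexponential.
Context {R : realType}.
Implicit Types V W H : probability R R.

Lemma tail_ge0 V x : 0 <= tail V x.
Proof. exact: prob_ge0. Qed.

Lemma le_tail V x y : y <= x -> tail V x <= tail V y.
Proof.
move=> yx; apply: le_prob => // z; rewrite /= !in_itv/= !andbT.
exact: le_lt_trans.
Qed.

Lemma tail_cvg0 V : tail V x @[x --> +oo] --> (0 : R).
Proof.
pose X : {mfun R >-> R} := HB.pack (fun z : R => z)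
  (isMeasurableFun.Build _ _ R R (fun z : R => z) (@measurable_id _ R setT)).
by have /fine_cvgP[_] := cvg_ccdfy0 (P := V) X.
Qed.

Lemma prob_itv_tail V (a b : R) : a <= b ->
  prob V `]a, b] = tail V a - tail V b.
Proof.
move=> ab; apply/eqP; rewrite eq_sym subr_eq; apply/eqP.
apply: EFin_inj; rewrite EFinD -!probE// -measureU//; last first.
  rewrite -subset0 => z [] /=; rewrite !in_itv/= andbT => /andP[_ zb].
  by rewrite ltNge zb.
congr (V _); apply/seteqP; split=> z /=; rewrite !in_itv/= !andbT.
  by move=> az; case: (leP z b) => zb; [left; rewrite az|right].
by move=> [/andP[]//|]; exact: le_lt_trans.
Qed.

Lemma prob_itvcy V : halfline_dist V -> prob V `[0, +oo[ = 1.
Proof.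
move=> [V0 _]; apply: EFin_inj.
rewrite -probE// -(probability_setT V) -[LHS]adde0 -V0 -measureU//; last first.
  by rewrite -subset0 => z [] /=; rewrite !in_itv/= andbT ltNge => ->.
congr (V _); apply/seteqP; split=> z //= _; rewrite !in_itv/= andbT.
by case: (leP 0 z); [left|right].
Qed.

Lemma prob_itvcc_tail V (a : R) : halfline_dist V -> 0 <= a ->
  prob V `[0, a] = 1 - tail V a.
Proof.
move=> hV a0; apply/eqP; rewrite eq_sym subr_eq -(prob_itvcy hV); apply/eqP.
apply: EFin_inj; rewrite EFinD -!probE// -measureU//; last first.
  rewrite -subset0 => z [] /=; rewrite !in_itv/= andbT => /andP[_ za].
  by rewrite ltNge za.
congr (V _); apply/seteqP; split=> z /=; rewrite !in_itv/= !andbT.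
  by move=> z0; case: (leP z a) => za; [left; rewrite z0|right].
by move=> [/andP[]//|/ltW]; exact: le_trans.
Qed.

Definition sum_exceeds (x : R) : set (R * R) := [set z | x < z.1 + z.2].

Lemma measurable_sum_exceeds x : measurable (sum_exceeds x).
Proof. exact: measurable_exceed (@measurable_radd R). Qed.

Lemma class_S_conv2 V : class_S V ->
  prob (V \x V)%E (sum_exceeds x) / tail V x @[x --> +oo] --> (2 : R).
Proof.
move=> [_ /(_ 2 (leqnn 2))].
suff -> : (fun x => tail (dconvn V 2) x / tail V x) =
    fun x => prob (V \x V)%E (sum_exceeds x) / tail V x by [].
apply/funext => x; congr (_ / _); rewrite /tail /prob; congr (fine _).
congr (product_measure1 _ _ _).
by apply/seteqP; split=> z /=; rewrite /radd in_itv/= andbT.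
Qed.

Lemma class_S_conv2_le V (e : R) : class_S V -> 0 < e ->
  \forall x \near +oo, prob (V \x V)%E (sum_exceeds x) <= (2 + e) * tail V x.
Proof.
move=> SV e0; have lt2 : (2 : R) < 2 + e by rewrite ltrDl.
have /cvgr_lt/(_ _ lt2) lt := class_S_conv2 SV; near=> x.
have Vx : 0 < tail V x by apply: SV.1.2; near: x; exact: nbhs_pinfty_ge.
by rewrite -ler_pdivrMr//; apply/ltW; near: x.
Unshelve. all: by end_near. Qed.

(** Three disjoint ways for a sum to exceed [x]: the first term does so alone;
    the first is at most [y] and the second exceeds [x]; the first is in
    [(y, x]] and the second exceeds [x - y]. *)
Lemma class_S_shift_bound V (y x : R) : halfline_dist V -> 0 <= y -> y <= x ->
  tail V x + (1 - tail V y) * tail V x + (tail V y - tail V x) * tail V (x - y)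
  <= prob (V \x V)%E (sum_exceeds x).
Proof.
move=> hV y0 yx.
rewrite -(prob_itvcc_tail hV y0) -(prob_itv_tail _ yx).
rewrite -[X in X + _ + _]mulr1 -(prob_itvcy hV) -!prob_rect//.
apply: prob_addU3_le; rewrite -?subset0.
- exact: measurableX.
- exact: measurableX.
- exact: measurableX.
- exact: measurable_sum_exceeds.
all: move=> [z1 z2]; rewrite /sum_exceeds/= !in_itv/= ?andbT.
- by move=> [[? ?] [/andP[? ?] ?]]; lra.
- by move=> [[? ?] [/andP[? ?] ?]]; lra.
- by move=> [[/andP[? ?] ?] [/andP[? ?] ?]]; lra.
- by move=> [? ?]; lra.
- by move=> [/andP[? ?] ?]; lra.
- by move=> [/andP[? ?] ?]; lra.
Qed.

(** Subexponential laws are long-tailed: by [class_S_shift_bound], if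
    [tail V (x - y)] exceeded [tail V x] by a fixed factor, then the tail of
    the convolution would exceed [2 tail V x] by a fixed factor as well. *)
Lemma class_S_L V : class_S V -> class_L V.
Proof.
move=> SV; have hV := SV.1; split=> // y y0.
have ty : 0 < tail V y by apply: hV.2; exact: ltW.
apply/cvgrPdist_le => /= e e0.
(* [d] is chosen so that [tail V y + d = (1 + e) * (tail V y - d)]. *)
pose d := e * tail V y / (2 + e).
have d0 : 0 < d by rewrite /d divr_gt0 ?mulr_gt0// addr_gt0.
have dE : d * (2 + e) = e * tail V y by rewrite /d divfK// gt_eqF// addr_gt0.
near=> x.
have x0 : 0 <= x by near: x; exact: nbhs_pinfty_ge.
have yx : y <= x by near: x; apply: nbhs_pinfty_ge; exact: num_real.
have Vx : 0 < tail V x := hV.2 _ x0.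
have c2 : prob (V \x V)%E (sum_exceeds x) <= (2 + d) * tail V x.
  by near: x; exact: class_S_conv2_le.
have td : tail V x <= d.
  by apply/ltW; near: x; have /cvgr_lt := tail_cvg0 V; apply.
have lb := class_S_shift_bound hV (ltW y0) yx.
have xy : tail V x <= tail V (x - y) by apply: le_tail; rewrite gerBl ltW.
rewrite ler_distlC ler_pdivlMr// ler_pdivrMr//; apply/andP; split.
  by apply: le_trans xy; rewrite ler_piMl ?(ltW Vx)// lerBlDr lerDl ltW.
have ? : d < tail V y by nra.
have : tail V (x - y) * (tail V y - d) <= (tail V y + d) * tail V x.
  apply: (@le_trans _ _ ((tail V y - tail V x) * tail V (x - y))); last lra.
  by rewrite mulrC ler_wpM2r ?tail_ge0// lerD2l lerN2.
have td0 : 0 < tail V y - d by rewrite subr_gt0.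
rewrite -(ler_pdivlMr _ _ td0) => /le_trans; apply.
rewrite ler_pdivrMr// mulrAC ler_pM2r//; lra.
Unshelve. all: by end_near. Qed.

Lemma le_both_large (L L' x : R) : L' <= L -> both_large L x `<=` both_large L' x.
Proof. by move=> LL z [? ? ?]; split=> //; exact: le_lt_trans LL _. Qed.

(** Sums with one term in [[0, L]] and the other above [x] already account for
    [2 (1 - tail V L) tail V x] out of the total [~ 2 tail V x]. What is left
    is about [2 tail V L tail V x] at most, and [tail V L] is small. *)
Lemma class_S_both_large V (e : R) : class_S V -> 0 < e ->
  exists2 L, 0 <= L & \forall x \near +oo,
    prob (V \x V)%E (both_large L x) <= e * tail V x.
Proof.
move=> SV e0; have hV := SV.1.
have e40 : 0 < e / 4 by rewrite divr_gt0.
have [L [L0 tL]] : exists L, 0 <= L /\ tail V L < e / 4.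
  near (+oo : set_system R) => L; exists L; split.
    by near: L; exact: nbhs_pinfty_ge.
  by near: L; have /cvgr_lt := tail_cvg0 V; apply.
exists L => //; near=> x.
have Lx : 2 * L < x by near: x; apply: nbhs_pinfty_gt; exact: num_real.
have c2 : prob (V \x V)%E (sum_exceeds x) <= (2 + e / 2) * tail V x.
  by near: x; apply: class_S_conv2_le => //; rewrite divr_gt0.
suff : prob (V \x V)%E (both_large L x) + (1 - tail V L) * tail V x +
    tail V x * (1 - tail V L) <= prob (V \x V)%E (sum_exceeds x).
  have := tail_ge0 V x; nra.
rewrite -(prob_itvcc_tail hV L0) -!prob_rect//.
apply: prob_addU3_le; rewrite -?subset0.
- exact: measurable_both_large.
- exact: measurableX.
- exact: measurableX.
- exact: measurable_sum_exceeds.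
all: move=> [z1 z2]; rewrite /sum_exceeds/= ?in_itv/= ?andbT.
- by move=> [[/= ? ? ?] [/andP[? ?] ?]]; lra.
- by move=> [[/= ? ? ?] [? /andP[? ?]]]; lra.
- by move=> [[/andP[? ?] ?] [? /andP[? ?]]]; lra.
- by move=> [].
- by move=> [/andP[? ?] ?]; lra.
- by move=> [? /andP[? ?]]; lra.
Unshelve. all: by end_near. Qed.

Lemma prob_sum_exceeds_le V W L x :
  prob (V \x W)%E (sum_exceeds x) <=
  tail V (x - L) + tail W (x - L) + prob (V \x W)%E (both_large L x).
Proof.
have mV := measurable_itv (R := R) `]x - L, +oo[.
rewrite -[tail V _]mulr1 -[tail W _]mul1r.
have T1 (U : probability R R) : 1 = prob U setT :> R by rewrite /prob probability_setT.
rewrite [X in tail V _ * X](T1 W) [X in X * tail W _](T1 V) -!prob_rect//.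
have m1 : measurable (`]x - L, +oo[%classic `*` [set: R]) by exact: measurableX.
have m2 : measurable ([set: R] `*` `]x - L, +oo[%classic) by exact: measurableX.
have m3 := measurable_both_large L x.
have m4 := measurable_sum_exceeds x.
apply: (@le_trans _ _ (prob (V \x W)%E (`]x - L, +oo[%classic `*` [set: R] `|`
  [set: R] `*` `]x - L, +oo[%classic) + prob (V \x W)%E (both_large L x))).
  apply: probU_le => //; first exact: measurableU.
  move=> [z1 z2]; rewrite /sum_exceeds /both_large /= !in_itv/= !andbT => xz.
  case: (leP z1 L) => z1L; first by left; right; split=> //; move: xz; lra.
  case: (leP z2 L) => z2L; first by left; left; split=> //; move: xz; lra.
  by right.
by rewrite lerD2r; apply: probU_le => //; exact: measurableU.
Qed.

(** Stochastic domination transfers the estimate for [H] to [V] and [W], but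
    with [tail H] as comparison; the other bound on [tail H] says in turn that
    it is at most [tail V + tail W] up to a constant, because the part of the
    convolution with two large terms can be absorbed on the left. *)
Lemma both_large_negligible V W H (e : R) :
  class_L V -> class_L W -> class_S H ->
  (forall x, tail V x <= tail H x) -> (forall x, tail W x <= tail H x) ->
  (forall x, 0 <= x -> tail H x <= prob (V \x W)%E (sum_exceeds x)) ->
  0 < e -> exists2 L, 0 <= L & \forall x \near +oo,
    prob (V \x W)%E (both_large L x) <= e * (tail V x + tail W x).
Proof.
move=> LV LW SH VH WH HVW e0.
(* [d <= 1 / 2] lets [d * tail H x] be absorbed, which yields
   [tail H x <= 4 * (tail V x + tail W x)]; then [4 * d <= e] concludes. *)
pose d := Num.min (e / 8) (1 / 2).
have d0 : 0 < d by rewrite lt_min !divr_gt0.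
have de : d <= e / 8 by rewrite ge_min lexx.
have d2 : d <= 1 / 2 by rewrite ge_min lexx orbT.
have H_le (h v w vL wL q : R) : 0 <= h -> h <= vL + wL + q ->
    vL <= (1 + 1) * v -> wL <= (1 + 1) * w -> q <= d * h -> h <= 4 * (v + w).
  by move=> *; have : d * h <= 1 / 2 * h; [exact: ler_wpM2r|lra].
have q_le (v w : R) : 0 <= v -> 0 <= w -> d * (4 * (v + w)) <= e * (v + w).
  move=> v0 w0; apply: (@le_trans _ _ (e / 8 * (4 * (v + w)))).
    by rewrite ler_wpM2r// mulr_ge0// addr_ge0.
  by have : 0 <= e * (v + w); [rewrite mulr_ge0 ?(ltW e0)// addr_ge0|lra].
have [L L0 HL] := class_S_both_large SH d0.
exists L => //; near=> x.
have x0 : 0 <= x by near: x; exact: nbhs_pinfty_ge.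
have q : prob (V \x W)%E (both_large L x) <= d * tail H x.
  apply: le_trans (_ : prob (H \x H)%E (both_large L x) <= _); last by near: x.
  have mQ := @measurable_both_large _ L x.
  rewrite -lee_fin -!probE//.
  apply: le_trans (product_measure_both_large_le V L x WH) _.
  rewrite product_measure_both_largeC.
  exact: product_measure_both_large_le.
have h := le_trans (HVW x x0) (prob_sum_exceeds_le V W L x).
have v : tail V (x - L) <= (1 + 1) * tail V x.
  by near: x; exact: class_L_shift.
have w : tail W (x - L) <= (1 + 1) * tail W x.
  by near: x; exact: class_L_shift.
have H4 := H_le _ _ _ _ _ _ (tail_ge0 H x) h v w q.
apply: le_trans q _; apply: le_trans (ler_wpM2l (ltW d0) H4) _.
by apply: q_le; exact: tail_ge0.
Unshelve. all: by end_near. Qed.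

End subexponential.

(** * Regression dependence *)

Section regression_dependence.
Context {R : realType} {disp} {T : measurableType disp} (P : probability T R).
Variables (n : nat) (Y : 'I_n -> T -> R).
Hypothesis n_gt0 : (0 < n)%N.
Hypothesis mY : forall i, measurable_fun setT (Y i).
Variable V : 'I_n -> probability R R.
Hypothesis VE : forall i x, tail (V i) x = prob P (exceedance Y i x).
Hypothesis SV : forall i, class_S (V i).
Hypothesis RDY : RD P Y.
Hypothesis pair_large : forall i j (e : R), i != j -> 0 < e ->
  exists2 L, 0 <= L & \forall x \near +oo,
    prob (V i \x V j)%E (both_large L x) <= e * (tail (V i) x + tail (V j) x).

Local Notation G := (sum_tails P Y).
Local Notation exceed i x := (exceedance Y i x).

Let hV i : halfline_dist (V i) := (SV i).1.
Let G_ge0 x := sum_tails_ge0 P Y x.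
Let G_gt0 x := @sum_tails_gt0 _ _ _ P n Y n_gt0 V VE hV x.

Lemma pairs_negligible (e : R) : 0 < e ->
  exists2 L0, 0 <= L0 & forall L y, L0 <= L -> 0 <= y ->
    \forall x \near +oo, forall i j,
      prob (V i \x V j)%E (both_large L (x - y)) <= e * G x.
Proof.
(* Two tails are at most [2 * G x], and the shift by [y] costs another
   factor 2. *)
move=> e0; have e40 : 0 < e / 4 by rewrite divr_gt0.
have H (ij : 'I_n * 'I_n) : exists L, 0 <= L /\ \forall x \near +oo,
    prob (V ij.1 \x V ij.2)%E (both_large L x) <= e / 4 * (G x + G x).
  have tG i x : tail (V i) x <= G x by rewrite VE; exact: prob_exceed_le.
  case: ij => i j /=; have [->|ij] := eqVneq i j.
    have [L L0 VL] := class_S_both_large (SV j) e40; exists L; split=> //.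
    apply: filterS VL => x /le_trans; apply; rewrite ler_pM2l//.
    by apply: le_trans (tG j x) _; rewrite lerDl.
  have [L L0 VL] := pair_large ij e40; exists L; split=> //.
  by apply: filterS VL => x /le_trans; apply; rewrite ler_pM2l// lerD.
have [L HL] := choice H; exists (\sum_ij `|L ij|); first by rewrite sumr_ge0.
move=> L' y LL' y0.
have near_all : \forall x \near +oo, forall ij : 'I_n * 'I_n,
    prob (V ij.1 \x V ij.2)%E (both_large L' x) <= e / 4 * (G x + G x).
  apply: filter_forall => ij; apply: filterS (HL ij).2 => x /(le_trans _); apply.
  apply: le_prob; [exact: measurable_both_large..|].
  apply: le_both_large; apply: le_trans LL'; apply: le_trans (ler_norm _) _.
  by rewrite (bigD1 ij)//= lerDl sumr_ge0.
have shift : \forall x \near +oo, G (x - y) <= (1 + 1) * G x.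
  by apply: (sum_tails_near_shift VE) => // i; exact: class_S_L.
have near_all_y := near_pinfty_shift y near_all.
apply: filterS2 near_all_y shift => x Hx Gx i j; apply: le_trans (Hx (i, j)) _.
move: (G x) (G (x - y)) Gx => g g' g'g; have : e * g' <= e * ((1 + 1) * g).
  by rewrite ler_pM2l.
lra.
Qed.

(** Beyond a point [X] this is [pairs_negligible]; up to [X], the sum of the
    tails is at least its value at [X]. *)
Lemma pairs_bounded : exists L0 c : R, [/\ 0 <= L0, 0 <= c &
  forall L x i j, L0 <= L -> 0 <= x ->
    prob (V i \x V j)%E (both_large L (x - 1)) <= c * G x].
Proof.
have [L0 L00 HL] := pairs_negligible ltr01.
have [M [_ HM]] := HL _ _ (lexx L0) ler01.
pose X := Num.max 0 (M + 1); have X0 : 0 <= X by rewrite le_max lexx.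
have GX := G_gt0 X0.
exists L0, (1 + (G X)^-1); split=> //.
  by rewrite addr_ge0// invr_ge0 ltW.
move=> L x i j LL x0.
apply: (@le_trans _ _ (prob (V i \x V j)%E (both_large L0 (x - 1)))).
  by apply: le_prob; [exact: measurable_both_large..|exact: le_both_large].
rewrite mulrDl; have [xX|Xx] := leP x X; last first.
  apply: le_trans (HM x _ i j) _.
    by apply: lt_trans Xx; rewrite lt_max ltrDl ltr01 orbT.
  by rewrite lerDl mulr_ge0// invr_ge0 ltW.
apply: (@le_trans _ _ 1); first by apply: prob_le1; exact: measurable_both_large.
rewrite -[leLHS]add0r lerD//; first by rewrite mul1r.
by rewrite ler_pdivlMl// mulr1; exact: le_sum_tails.
Qed.

Definition all_large (J : {set 'I_n}) (L : R) : set T :=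
  [set w | forall j, j \in J -> L < Y j w].

Definition partial_sum (J : {set 'I_n}) (w : T) : R := \sum_(j in J) Y j w.

Lemma measurable_all_large J L : measurable (all_large J L).
Proof.
apply: measurable_forall => j; case: (boolP (j \in J)) => jJ.
  rewrite (_ : (fun _ => _) = [set w | L < Y j w]).
    exact: measurable_exceed.
  by apply/seteqP; split=> w /=; [exact|move=> ? _].
by rewrite (_ : (fun _ => _) = setT)//; apply/seteqP; split.
Qed.

Lemma measurable_partial_sum J : measurable_fun setT (partial_sum J).
Proof.
rewrite (_ : partial_sum J = fun w => \sum_j (if j \in J then Y j w else 0)).
  by apply: measurable_sum => j; case: (j \in J).
by apply/funext => w; rewrite /partial_sum big_mkcond.
Qed.

Lemma measurable_large_sum J L x :
  measurable (all_large J L `&` [set w | x < partial_sum J w]).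
Proof.
apply: measurableI; first exact: measurable_all_large.
by apply: measurable_exceed; exact: measurable_partial_sum.
Qed.

Lemma partial_sum_gt J L w : 0 <= L -> J != finset.set0 -> all_large J L w ->
  L < partial_sum J w.
Proof.
move=> L0 /finset.set0Pn[j jJ] LJ; rewrite /partial_sum (bigD1 j)//=.
rewrite ltr_wpDr//; last exact: LJ.
by apply: sumr_ge0 => k /andP[kJ _]; apply/ltW/(le_lt_trans L0)/LJ.
Qed.

Lemma measurable_subtuple J : measurable_fun setT (subtuple Y J).
Proof.
apply/measurable_fun_tnthP => k.
by rewrite (_ : _ \o _ = Y (enum_val k))//; apply/funext => w /=; rewrite tnth_mktuple.
Qed.

Lemma subtuple_preimage J L a :
  subtuple Y J @^-1` [set y | (forall k, L < tnth y k) /\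
    a <= \sum_k tnth y k < a + 1] =
  all_large J L `&` [set w | a <= partial_sum J w < a + 1].
Proof.
have sumE w : \sum_k tnth (subtuple Y J w) k = partial_sum J w.
  rewrite /partial_sum [RHS]big_enum_val.
  by apply: eq_bigr => k _; rewrite tnth_mktuple.
apply/seteqP; split=> w /=; rewrite sumE => -[LY aY]; split=> // k.
  move=> kJ; have := LY (enum_rank_in kJ k).
  by rewrite tnth_mktuple enum_rankK_in.
by rewrite tnth_mktuple; apply: LY; exact: enum_valP.
Qed.

(** The event that the terms of [J] are large and their sum is in a unit cell
    depends on the conditioning variables only, so the conditional bound can be
    integrated over it. *)
Lemma RD_cell : exists x0 C : R, 0 <= C /\
  forall (J : {set 'I_n}) i L a t, J != finset.set0 -> i \notin J ->
    x0 < L -> L <= t ->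
    (P (all_large J L `&` [set w | (a <= partial_sum J w < a + 1)%R] `&`
        [set w | (t < Y i w)%R]) <=
     C%:E * (P (all_large J L `&` [set w | (a <= partial_sum J w < a + 1)%R]) *
             V i `]t, +oo[%classic))%E.
Proof.
have [x0 [C RDC]] := RDY.
exists x0, (Num.max 0 C); split; first by rewrite le_max lexx.
move=> J i L a t J0 iJ x0L Lt.
have [K KP KC] := RDC i J J0 iJ.
pose D : set (#|J|.-tuple R) := [set y | (forall k, L < tnth y k) /\
  a <= \sum_k tnth y k < a + 1].
have mD : measurable D.
  apply: measurableI; last first.
    by apply: measurable_band; apply: measurable_sum => k; exact: measurable_tnth.
  apply: measurable_forall => k.
  by apply: measurable_exceed; exact: measurable_tnth.
have mDY : measurable (subtuple Y J @^-1` D).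
  by rewrite -[X in measurable X]setTI; exact: measurable_subtuple.
have Vi : V i `]t, +oo[%classic = P [set w | t < Y i w].
  rewrite [LHS]probE// [RHS]probE; first by congr EFin; exact: VE.
  exact: measurable_exceed.
rewrite -subtuple_preimage -/D setIC Vi.
have -> : [set w | t < Y i w] = Y i @^-1` `]t, +oo[.
  by apply/seteqP; split=> w; rewrite /= in_itv/= andbT.
rewrite KP//.
apply: (@le_trans _ _ (\int[P]_(w in subtuple Y J @^-1` D)
    ((Num.max 0 C)%:E * P (Y i @^-1` `]t, +oo[%classic)))%E).
  apply: ge0_le_integral => //.
    apply: measurable_funTS.
    apply: (measurableT_comp (measurable_kernel K _ _)) => //.
    exact: measurable_subtuple.
  move=> w [Lw _]; apply: le_trans (KC t _ _) _.
    by move=> k; rewrite lt_min (lt_le_trans x0L Lt) (lt_trans x0L).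
  rewrite (_ : [set w | t < Y i w] = Y i @^-1` `]t, +oo[); last first.
    by apply/seteqP; split=> w' /=; rewrite in_itv/= andbT.
  by rewrite lee_wpmul2r// lee_fin le_max lexx orbT.
rewrite integral_cst// -muleA lee_wpmul2l//; first by rewrite lee_fin le_max lexx.
by rewrite muleC.
Qed.

Lemma all_largeU1 (J : {set 'I_n}) i L x : i \notin J ->
  all_large (i |: J) L `&` [set w | x < partial_sum (i |: J) w] `<=`
  all_large J L `&` [set w | L < Y i w /\ x < partial_sum J w + Y i w].
Proof.
move=> iJ w [LY]; rewrite /= /partial_sum big_setU1//= addrC => xY.
by split; [move=> j jJ; apply: LY|split=> //; apply: LY];
   rewrite !inE ?jJ ?orbT// eqxx.
Qed.

Lemma tail_fineE i t : (V i `]t, +oo[%classic = (tail (V i) t)%:E)%E.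
Proof. by rewrite probE. Qed.

(** Adding a term to a sum of large terms: regression dependence lets the new
    term be treated as independent, up to the factor [C], and the bound [cG] on
    the old sum then lets that sum be replaced by one independent copy of each
    [Y j] in turn. *)
Lemma RD_step : exists x0 C : R, 0 <= C /\
  forall (J : {set 'I_n}) i L c x, J != finset.set0 -> i \notin J ->
    x0 < L -> 0 <= L -> 0 <= c ->
    (forall y, 0 <= y ->
      prob P (all_large J L `&` [set w | y < partial_sum J w]) <= c * G y) ->
    prob P (all_large (i |: J) L `&` [set w | x < partial_sum (i |: J) w]) <=
    C * c * \sum_j prob (V i \x V j)%E (both_large L (x - 1)).
Proof.
have [x0 [C [C0 cell]]] := RD_cell; exists x0, C; split=> //.
move=> J i L c x J0 iJ x0L L0 c0 cG.
have mS := measurable_partial_sum J.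
have mL := measurable_all_large J L.
have mQ := @measurable_both_large _ L (x - 1).
have mE := measurable_large_pair L (x - 1) mL mS.
rewrite -lee_fin -probE; last exact: measurable_large_sum.
apply: (@le_trans _ _ (P (all_large J L `&`
    [set w | (L < Y i w)%R /\ (x < partial_sum J w + Y i w)%R]))).
  rewrite le_measure ?inE//; [exact: measurable_large_sum| |exact: all_largeU1].
  apply: measurableI => //; apply: measurableI; first exact: measurable_exceed.
  exact: measurable_exceed (measurable_funD mS (mY i)).
have S0 w : all_large J L w -> 0 <= partial_sum J w.
  by move=> LY; apply/ltW/(le_lt_trans L0)/(partial_sum_gt L0 J0).
apply: le_trans (prob_sum_le_product x mL mS (mY i) C0 S0
  (fun a t => cell J i L a t J0 iJ x0L)) _.
rewrite -mulrA EFinM lee_wpmul2l//.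
suff : ((P \x V i) [set z | [/\ all_large J L z.1, (L < z.2)%R &
    (x - 1 < partial_sum J z.1 + z.2)%R]] <=
    c%:E * \sum_j (V i \x V j) (both_large L (x - 1)))%E.
  move=> /le_trans; apply; rewrite EFinM -sumEFin lee_wpmul2l//.
  by apply: lee_sum => j _; rewrite probE.
apply: product_measure_le_both_large => //.
move=> t; have [Lt|tL] := ltP L t; [right; split=> //|left].
  pose y := Num.max L (x - 1 - t).
  have y0 : 0 <= y by rewrite le_max L0.
  rewrite (_ : ysection _ t =
      all_large J L `&` [set w | y < partial_sum J w]); last first.
    apply/seteqP; split=> w; rewrite /ysection/= inE/=.
      move=> [LY _ xY]; split=> //.
      by rewrite gt_max (partial_sum_gt L0 J0)//= ltrBlDr.
    by move=> [LY]; rewrite gt_max ltrBlDr => /andP[_ xY].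
  rewrite probE; last exact: measurable_large_sum.
  rewrite (eq_bigr (fun j => (tail (V j) y)%:E)) => [|j _]; last exact: tail_fineE.
  rewrite sumEFin -EFinM lee_fin; apply: le_trans (cG y y0) _.
  by rewrite ler_wpM2l// /sum_tails; apply: ler_sum => j _; rewrite VE.
apply/seteqP; split=> w //; rewrite /ysection/= inE/= => -[_ Lt _].
by move: Lt; rewrite ltNge tL.
Qed.

(** Induction on the number of terms; the bound is uniform in the level [L],
    so that [L] may be taken large afterwards. *)
Lemma RD_sum_bounded : exists L0 : R, exists2 c : R, 0 <= c &
  forall (J : {set 'I_n}) L x, J != finset.set0 -> L0 < L -> 0 <= x ->
    prob P (all_large J L `&` [set w | x < partial_sum J w]) <= c * G x.
Proof.
have [x0 [C [C0 step]]] := RD_step.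
have [L1 [c1 [L10 c10 pairs]]] := pairs_bounded.
exists (Num.max x0 L1).
suff H (J : {set 'I_n}) : exists c, 0 <= c /\ (J != finset.set0 ->
    forall L x, Num.max x0 L1 < L -> 0 <= x ->
    prob P (all_large J L `&` [set w | x < partial_sum J w]) <= c * G x).
  have [c Hc] := choice H; exists (\sum_J c J).
    by apply: sumr_ge0 => J _; exact: (Hc J).1.
  move=> J L x J0 LL x0'; apply: le_trans ((Hc J).2 J0 L x LL x0') _.
  apply: ler_wpM2r; first exact: G_ge0.
  by rewrite (bigD1 J)//= lerDl sumr_ge0// => K _; exact: (Hc K).1.
elim: {J}#|J| {-2}J (erefl #|J|) => [|k IH] J cJ.
  by exists 0; split=> //; rewrite -finset.cards_eq0 cJ.
have [i iJ] : exists i, i \in J by apply/finset.set0Pn; rewrite -finset.cards_eq0 cJ.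
have cJi : #|J :\ i| = k by move: cJ; rewrite (finset.cardsD1 i) iJ => -[].
have [c [c0 cIH]] := IH _ cJi.
have [Ji0|Ji0] := eqVneq (J :\ i) finset.set0.
  exists 1; split=> // _ L x _ x0'; rewrite mul1r.
  apply: le_trans (prob_exceed_le P Y i x).
  apply: le_prob; [exact: measurable_large_sum|exact: measurable_exceedance|].
  move=> w [_]; rewrite /partial_sum /= -(finset.setD1K iJ) Ji0 finset.setU0.
  by rewrite big_set1.
exists (C * c * (n%:R * c1)); split.
  by rewrite !mulr_ge0.
move=> _ L x; rewrite gt_max => /andP[x0L L1L] x0'.
have L0 : 0 <= L by apply/ltW/(le_lt_trans L10).
rewrite -(finset.setD1K iJ).
apply: (le_trans (step (J :\ i) i L c x Ji0 _ x0L L0 c0 _)).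
- by rewrite !inE eqxx.
- by move=> y y0; apply: cIH => //; rewrite gt_max x0L.
rewrite -[leRHS]mulrA ler_wpM2l ?mulr_ge0//.
apply: (@le_trans _ _ (\sum_(j < n) c1 * G x)).
  by apply: ler_sum => j _; apply: pairs => //; exact: ltW.
by rewrite sumr_const card_ord -[_ *+ n]mulr_natl mulrA.
Qed.

(** One term is split off by [RD_step]. The sum of the others satisfies the
    bound of [RD_sum_bounded], whose constant does not depend on [L]; so a large
    [L] makes the remaining estimate for pairs as small as required. *)
Lemma RD_sum_negligible (e : R) : 0 < e -> exists2 L, 0 <= L &
  forall y, 0 <= y -> \forall x \near +oo, forall J : {set 'I_n}, (1 < #|J|)%N ->
    prob P (all_large J L `&` [set w | x - y < partial_sum J w]) <= e * G x.
Proof.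
move=> e0; have [x0 [C [C0 step]]] := RD_step.
have [L1 [c c0 sum_le]] := RD_sum_bounded.
have D0 : 0 < C * c * n%:R + 1 by rewrite ltr_wpDl// !mulr_ge0.
pose e' := e / (C * c * n%:R + 1).
have e'0 : 0 < e' by rewrite divr_gt0.
have [L2 L20 pairs] := pairs_negligible e'0.
pose L := Num.max x0 (Num.max L1 L2) + 1.
have xL : Num.max x0 (Num.max L1 L2) < L by rewrite ltrDl.
move: xL; rewrite !gt_max => /and3P[x0L L1L L2L].
have L0 : 0 <= L by apply/ltW/(le_lt_trans L20).
exists L => // y y0.
(* [RD_step] shifts by 1, in addition to [y]. *)
have y10 : 0 <= y + 1 by rewrite addr_ge0.
apply: filterS (pairs L (y + 1) (ltW L2L) y10) => x px J cJ.
have J0 : J != finset.set0 by rewrite -finset.card_gt0; exact: leq_trans cJ.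
have [i iJ] := finset.set0Pn _ J0.
have Ji0 : J :\ i != finset.set0.
  by rewrite -finset.card_gt0; move: cJ; rewrite (finset.cardsD1 i) iJ.
rewrite -(finset.setD1K iJ).
apply: (le_trans (step (J :\ i) i L c (x - y) Ji0 _ x0L L0 c0 _)).
- by rewrite !inE eqxx.
- by move=> z z0; exact: sum_le.
apply: (@le_trans _ _ (C * c * (\sum_(j < n) e' * G x))).
  apply: ler_wpM2l; first by rewrite mulr_ge0.
  by apply: ler_sum => j _; rewrite -addrA -opprD; exact: px.
rewrite sumr_const card_ord -[_ *+ n]mulr_natl !mulrA.
apply: ler_wpM2r; first exact: G_ge0.
rewrite ler_pdivrMr// mulrC ler_pM2l//.
by rewrite lerDl.
Qed.

Lemma RD_overlap_le (e : R) i j : 0 < e -> i != j ->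
  \forall x \near +oo, prob P (exceed i x `&` exceed j x) <= e * G x.
Proof.
move=> e0 ij; have [L L0 HL] := RD_sum_negligible e0; near=> x.
have Lx : L <= x by near: x; apply: nbhs_pinfty_ge; exact: num_real.
have HJ : forall J : {set 'I_n}, (1 < #|J|)%N ->
    prob P (all_large J L `&` [set w | x - 0 < partial_sum J w]) <= e * G x.
  by near: x; exact: HL.
apply: le_trans (HJ [set i; j]%SET _); last by rewrite finset.cards2 ij.
apply: le_prob; [exact: measurable_overlap|exact: measurable_large_sum|].
move=> w [/= xi xj]; split=> /=.
  by move=> k; rewrite !inE => /orP[] /eqP->; exact: le_lt_trans Lx _.
rewrite subr0 /partial_sum big_setU1 ?inE//= big_set1 -[x]addr0 ltrD//.
by apply: le_lt_trans xj; exact: le_trans Lx.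
Unshelve. all: by end_near. Qed.

(** With the constant allowance [n L], the terms not above [L] add up to at
    most [n L]; so at least two terms are above [L] and the sum of those that
    are exceeds [x - n L]. *)
Lemma RD_remainder_le (e : R) : 0 < e ->
  exists h : R -> R, \forall x \near +oo,
    \sum_i prob P (exceed i (x - h x)) <= (1 + e) * G x /\
    prob P [set w | x < \sum_i Y i w /\ forall i, Y i w <= x - h x]
      <= e * G x.
Proof.
move=> e0; pose N := #|{: {set 'I_n}}|.+1.
have e'0 : 0 < e / N%:R by rewrite divr_gt0.
have [L L0 HL] := RD_sum_negligible e'0.
have h0 : 0 <= n%:R * L by rewrite mulr_ge0.
exists (fun=> n%:R * L); near=> x.
have hx : n%:R * L <= x by near: x; apply: nbhs_pinfty_ge; exact: num_real.
split.
  rewrite -/(sum_tails _ _ _); near: x.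
  by apply: (sum_tails_near_shift VE) => // i; exact: class_S_L.
have HJ : forall J : {set 'I_n}, (1 < #|J|)%N ->
    prob P (all_large J L `&` [set w | x - n%:R * L < partial_sum J w])
    <= e / N%:R * G x by near: x; exact: HL.
apply: (@le_trans _ _ (\sum_(J : {set 'I_n} | (1 < #|J|)%N)
    prob P (all_large J L `&` [set w | x - n%:R * L < partial_sum J w]))).
  apply: prob_bigcup_le.
  - exact: measurable_remainder.
  - by move=> J; exact: measurable_large_sum.
  move=> w [xY Yh]; pose J : {set 'I_n} := [set j | L < Y j w]%SET.
  have sumJ : \sum_i Y i w <= partial_sum J w + n%:R * L.
    rewrite (bigID (fun i => i \in J))/= lerD2l.
    apply: (@le_trans _ _ (\sum_(i < n) L)); last first.
      by rewrite sumr_const card_ord mulr_natl.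
    rewrite big_mkcond/=; apply: ler_sum => i _.
    by rewrite inE -leNgt; case: ifP.
  have xJ : x - n%:R * L < partial_sum J w.
    by rewrite ltrBlDr; exact: lt_le_trans sumJ.
  exists J; last by split=> // j; rewrite inE.
  rewrite ltnNge; apply/negP => J1; move: xJ; apply/negP; rewrite -leNgt.
  have [J0|] := eqVneq J finset.set0.
    by rewrite /partial_sum J0 big_set0 subr_ge0.
  rewrite -finset.card_gt0 => J0.
  have /finset.cards1P[i ->] : #|J| == 1%N by rewrite eqn_leq J1.
  by rewrite /partial_sum big_set1.
apply: (@le_trans _ _ (\sum_(J : {set 'I_n}) e / N%:R * G x)).
  rewrite big_mkcond/=; apply: ler_sum => J _.
  case: ifP => [/HJ//|_].
  by rewrite mulr_ge0 ?(ltW e'0)//; exact: G_ge0.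
rewrite sumr_const -[leLHS]mulr_natl mulrA ler_wpM2r ?G_ge0//.
rewrite mulrCA ler_piMr ?(ltW e0)// ler_pdivrMr// mul1r ler_nat.
by rewrite /N leqnSn.
Unshelve. all: by end_near. Qed.

End regression_dependence.

(** * The convolution of two laws on the orthant, seen through the gauge *)

Section independent_copies.
Context {R : realType} {d : nat} (A : rfamily R d).
Implicit Types F : probability (rvec R d) R.

Lemma product_dirdistE F1 F2 (E : set (R * R)) : measurable E ->
  (dirdist A F1 \x dirdist A F2)%E E =
  (F1 \x F2)%E [set z | E (ydir A z.1, ydir A z.2)].
Proof.
move=> mE; rewrite /product_measure1.
rewrite ge0_integral_distribution//; exact: measurable_fun_xsection.
Qed.

Lemma tail_dirdist F x : tail (dirdist A F) x = prob F [set v | x < ydir A v].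
Proof.
rewrite /tail /prob; congr (fine (F _)).
by apply/seteqP; split=> v /=; rewrite in_itv/= andbT.
Qed.

Lemma measurable_ydir_gt x : measurable [set v : rvec R d | x < ydir A v].
Proof. exact: measurable_exceed (measurable_ydir A). Qed.

Lemma measurable_vadd_gt x :
  measurable [set z : rvec R d * rvec R d | x < ydir A (vadd z)].
Proof.
apply: measurable_exceed.
exact: measurableT_comp (measurable_ydir A) (@measurable_vadd R d).
Qed.

Lemma tail_vconv F1 F2 x : tail (dirdist A (vconv F1 F2)) x =
  prob (F1 \x F2)%E [set z | x < ydir A (vadd z)].
Proof. by rewrite tail_dirdist. Qed.

Lemma tail_vconv_le F1 F2 x :
  tail (dirdist A (vconv F1 F2)) x <=
  prob (dirdist A F1 \x dirdist A F2)%E (sum_exceeds x).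
Proof.
have mE := @measurable_sum_exceeds _ x.
have -> : prob (dirdist A F1 \x dirdist A F2)%E (sum_exceeds x) =
    prob (F1 \x F2)%E [set z | x < ydir A z.1 + ydir A z.2].
  by congr fine; exact: product_dirdistE.
rewrite tail_vconv; apply: le_prob.
- exact: measurable_vadd_gt.
- apply: measurable_exceed; apply: measurable_funD.
  + exact: (measurableT_comp (measurable_ydir A) measurable_fst).
  + exact: (measurableT_comp (measurable_ydir A) measurable_snd).
by move=> z /= /lt_le_trans; apply; exact: ydir_subadd.
Qed.

Definition orthant : set (rvec R d) := [set v | forall k, 0 <= (v : 'rV[R]_d) 0 k].

Lemma measurable_orthant : measurable orthant.
Proof.
apply: measurable_forall => k.
rewrite (_ : (fun _ => _) =
    ~` [set v : rvec R d | (v : 'rV[R]_d) 0 k < 0]).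
  by apply: measurableC; apply: measurable_below; exact: measurable_coord.
by apply/seteqP; split=> v /=; rewrite leNgt => /negP.
Qed.

(** Adding a vector of the orthant can only increase the gauge. *)
Lemma tail_le_vconv F1 F2 x : F1 orthant = 1%E -> F2 orthant = 1%E ->
  tail (dirdist A F1) x <= tail (dirdist A (vconv F1 F2)) x /\
  tail (dirdist A F2) x <= tail (dirdist A (vconv F1 F2)) x.
Proof.
move=> F11 F21; rewrite tail_vconv !tail_dirdist.
have mO := measurable_orthant; have mg := measurable_ydir_gt x.
have prob1 F : F orthant = 1%E -> prob F orthant = 1 by rewrite /prob => ->.
split.
  rewrite -[leLHS]mulr1 -(prob1 F2)// -prob_rect//.
  apply: le_prob; [exact: measurableX|exact: measurable_vadd_gt|].
  by move=> [v1 v2] /= [xv v20]; apply: lt_le_trans xv _; exact: ydir_mono.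
rewrite -[leLHS]mul1r -(prob1 F1)// -prob_rect//.
apply: le_prob; [exact: measurableX|exact: measurable_vadd_gt|].
move=> [v1 v2] /= [v10 xv]; apply: lt_le_trans xv _.
by rewrite /vadd/= addrC; exact: ydir_mono.
Qed.

End independent_copies.

Unset Implicit Arguments.

Theorem theorem4p1 (R : realType) (d : nat) (d_ge1 : (1 <= d)%N)
    (A : rfamily R d) (n : nat) (n_ge1 : (1 <= n)%N)
    (disp : measure_display) (T : measurableType disp) (P : probability T R)
    (X : 'I_n -> {mfun T >-> rvec R d})
    (X_ge0 : forall i w k, 0 <= (X i w : 'rV[R]_d) 0 k) :
  let F := fun i : 'I_n => vlaw P (X i) in
  let Y := fun (i : 'I_n) (w : T) => ydir A (X i w) in
  let conclusion := asymp_equiv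
    (fun x => prob P [set w | dilate x A (\sum_(i < n) (X i w : 'rV[R]_d))])
    (fun x => \sum_(i < n) prob P [set w | dilate x A (X i w)]) in
  [/\ QAI P Y /\ (forall i, on_set (@class_C R) A (F i)) -> conclusion,
      TAI P Y /\ (forall i, on_set (@class_DL R) A (F i)) -> conclusion &
      [/\ RD P Y,
          (forall i, on_set (@class_S R) A (F i)) &
          (forall i j, i != j -> on_set (@class_S R) A (vconv (F i) (F j)))]
        -> conclusion].
Proof.
move=> F Y conclusion.
pose V i := dirdist A (F i).
pose S w := ydir A (\sum_(i < n) (X i w : 'rV[R]_d)).
have mY i : measurable_fun setT (Y i).
  exact: measurableT_comp (measurable_ydir A) (@measurable_funPT _ _ _ _ (X i)).
have mS : measurable_fun setT S.
  apply: (measurableT_comp (measurable_ydir A)).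
  apply: measurable_fun_rvec => k.
  rewrite (_ : (fun _ => _) = fun w => \sum_(i < n) (X i w : 'rV[R]_d) 0 k).
    apply: measurable_sum => i.
    exact: measurableT_comp (measurable_coord k) (@measurable_funPT _ _ _ _ (X i)).
  by apply/funext => w; rewrite summxE.
have VE i x : tail (V i) x = prob P (exceedance Y i x).
  by rewrite /V tail_dirdist.
have YS i w : Y i w <= S w by apply: ydir_le_sum => j k; exact: X_ge0.
have SY w : S w <= \sum_i Y i w by exact: ydir_sum_le.
have concl : asymp_equiv (fun x => prob P [set w | x < S w]) (sum_tails P Y) ->
    conclusion.
  apply: cvg_trans; apply: near_eq_cvg; near=> x.
  have x0 : 0 < x by near: x; exact: nbhs_pinfty_gt.
  have E (v : T -> 'rV[R]_d) : [set w | x < ydir A (v w)] = [set w | dilate x A (v w)].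
    by apply/seteqP; split=> w /= /(dilate_ydir A (v w) x0).
  rewrite /S E /sum_tails; congr (_ / _).
  by apply: eq_bigr => i _; rewrite /exceedance /Y E.
split.
- move=> [qai CV]; apply: concl.
  have hV i : halfline_dist (V i) := (CV i).1.
  apply: (sum_tails_asymp_equiv mY mS YS SY).
  + by move=> x x0; exact: sum_tails_gt0.
  + by move=> e e0 i j ij; exact: QAI_overlap_le.
  + by move=> e e0; exact: QAI_remainder_le.
- move=> [tai DLV]; apply: concl.
  have hV i : halfline_dist (V i) := (DLV i).1.1.
  apply: (sum_tails_asymp_equiv mY mS YS SY).
  + by move=> x x0; exact: sum_tails_gt0.
  + by move=> e e0 i j ij; exact: TAI_overlap_le.
  + by move=> e e0; exact: TAI_remainder_le.
move=> [rd SV SVV]; apply: concl.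
have hV i : halfline_dist (V i) := (SV i).1.
have F1 i : F i (@orthant R d) = 1%E.
  rewrite -(probability_setT P) /F /vlaw; congr (P _).
  by apply/seteqP; split=> w //= _; exact: X_ge0.
have pair i j (e : R) : i != j -> 0 < e -> exists2 L, 0 <= L &
    \forall x \near +oo,
      prob (V i \x V j)%E (both_large L x) <= e * (tail (V i) x + tail (V j) x).
  move=> ij; apply: (both_large_negligible (H := dirdist A (vconv (F i) (F j)))).
  - exact: class_S_L (SV i).
  - exact: class_S_L (SV j).
  - exact: SVV.
  - by move=> x; have [] := tail_le_vconv A x (F1 i) (F1 j).
  - by move=> x; have [] := tail_le_vconv A x (F1 i) (F1 j).
  - by move=> x _; exact: tail_vconv_le.
apply: (sum_tails_asymp_equiv mY mS YS SY).
- by move=> x x0; exact: sum_tails_gt0.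
- by move=> e e0 i j ij; exact: RD_overlap_le.
- by move=> e e0; exact: RD_remainder_le.
Unshelve. all: by end_near. Qed.
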